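(* Let $(G,\mathbb{P})$ be relatively hyperbolic with $G$ finitely generated, and let $H\le G$ be a finitely generated subgroup. If $H$ is undistorted in $G$, then $H$ is relatively quasiconvex in $(G,\mathbb{P})$.
   Context: **Relative hyperbolicity.** Let $G$ be a countable group and $\mathbb{P}=\{P_1,\dots,P_n\}$ a finite collection of subgroups. $(G,\mathbb{P})$ is relatively hyperbolic if $G$ acts on a connected graph $K$ (edges of length one) such that: $K$ is $\delta$-hyperbolic for some $\delta$; $K$ is fine, i.e. for each $n$ each edge lies in only finitely many circuits (simple closed edge paths) of length $n$; edge stabilizers are finite; there are finitely many orbits of edges; and $\mathbb{P}$ is a set of representatives of the conjugacy classes of infinite vertex stabilizers. (The paper uses several equivalent definitions; this is one of them.) **Relative quasiconvexity.** A symmetric set $\mathcal{S}\subseteq G$ is a relative generating set for $(G,\mathbb{P})$ if $\mathcal{S}\cup P_1\cup\dots\cup P_n$ generates $G$. Let $\mathcal{P}$ be the union of the $P_i$ (nontrivial elements). A metric on $G$ is proper if all its balls are finite. A subgroup $H\le G$ is relatively quasiconvex in $(G,\mathbb{P})$ if for some (equivalently, any) finite relative generating set $\mathcal{S}$ and some (equivalently, any) proper left invariant metric $d$ on $G$ there is a constant $\kappa$ such that for each geodesic $\bar c$ in $\mathrm{Cayley}(G,\mathcal{S}\cup\mathcal{P})$ (edges of length one) connecting two points of $H$, every vertex of $\bar c$ lies within $d$-distance $\kappa$ of $H$. **Undistorted.** A finitely generated subgroup $H$ of a finitely generated group $G$ is undistorted if the inclusion $H\hookrightarrow G$ is a quasi-isometric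 embedding with respect to word metrics for finite generating sets. *)

(* Defs.v *)
From mathcomp Require Import all_boot all_order all_algebra.
From mathcomp Require Import boolp classical_sets cardinality reals.

Set Implicit Arguments.
Unset Strict Implicit.
Unset Printing Implicit Defensive.

Import Order.TTheory GRing.Theory Num.Theory.
Local Open Scope classical_set_scope.

Section Paths.
Variables (V : Type) (adj : rel V).

Definition walk (x y : V) (p : seq V) : Prop := path adj x p /\ last x p = y.

(* Path metric with edges of length one; it takes the dummy value 0 on pairs
   that no walk joins, so it is meaningful only for connected graphs. *)
Definition gdist (x y : V) : nat :=
  xget 0 [set n | (exists2 p, walk x y p & size p = n) /\
                  (forall q, walk x y q -> n <= size q)].

Definition connected_graph : Prop :=
  (exists x : V, True) /\ (forall x y, exists p, walk x y p).

Definition geodesic (x y : V) (p : seq V) : Prop :=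
  walk x y p /\ size p = gdist x y.

End Paths.

(* Rips condition for triangles of edge paths. Only vertices are considered:
   passing to the geometric realization changes delta by a bounded amount.
   Quantifying over all x, y, z covers all three sides, as adj is symmetric in
   all uses. *)
Definition hyperbolic (V : eqType) (adj : rel V) (delta : nat) : Prop :=
  forall (x y z : V) (p q r : seq V),
    geodesic adj x y p -> geodesic adj y z q -> geodesic adj x z r ->
    forall v, v \in x :: r ->
    exists2 w, w \in (x :: p) ++ (y :: q) & gdist adj v w <= delta.

(* Graphs in the sense of Serre: loops and multiple edges are allowed, and an
   (unoriented) edge is a pair {e, rev e} of opposite darts. *)
Record graph := Graph {
  vertex : choiceType;
  dart : choiceType;
  src : dart -> vertex;
  rev : dart -> dart;
  revK : involutive rev;
  rev_neq : forall e, rev e != e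
}.

Section Graph.
Variable K : graph.

Definition tgt (e : dart K) : vertex K := src (rev e).

Definition adjacent : rel (vertex K) :=
  [rel x y | `[< exists e : dart K, src e = x /\ tgt e = y >]].

Definition same_edge : rel (dart K) := [rel e f | (f == e) || (f == rev e)].

(* The last condition only matters for closed paths of length two: it excludes
   backtracking along one edge, but keeps pairs of parallel edges. *)
Definition circuit (c : seq (dart K)) : Prop :=
  [/\ c != [::],
      cycle [rel e f | tgt e == src f] c,
      uniq [seq src e | e <- c]
    & forall e, e \in c -> rev e \notin c].

(* Circuits are counted with a base point and an orientation, which multiplies
   their number by at most twice their length. *)
Definition fine : Prop :=
  forall (n : nat) (e : dart K),
    finite_set [set c | [/\ circuit c, size c = n & has (same_edge e) c]].

End Graph.

Record graph_action (G : groupType) (K : graph) := GraphAction {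
  actv : G -> vertex K -> vertex K;
  actd : G -> dart K -> dart K;
  actv1 : forall x, actv 1%g x = x;
  actvM : forall g h x, actv (g * h)%g x = actv g (actv h x);
  actd1 : forall e, actd 1%g e = e;
  actdM : forall g h e, actd (g * h)%g e = actd g (actd h e);
  act_src : forall g e, src (actd g e) = actv g (src e);
  act_rev : forall g e, rev (actd g e) = actd g (rev e)
}.

Definition vertex_stab (G : groupType) (K : graph) (a : graph_action G K)
  (x : vertex K) : set G := [set g | actv a g x = x].

(* Setwise stabilizer: inversions of edges are allowed. *)
Definition edge_stab (G : groupType) (K : graph) (a : graph_action G K)
  (e : dart K) : set G := [set g | same_edge e (actd a g e)].

Section Groups.
Variable G : groupType.

Definition is_subgroup (H : set G) : Prop := group_closed [in H].

Definition generated (A : set G) : set G := smallest is_subgroup A.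

Definition finitely_generated (H : set G) : Prop :=
  exists2 A : set G, finite_set A & generated A = H.

Definition symmetric_set (A : set G) : Prop := forall x, A x -> A x^-1%g.

Definition cayley (A : set G) : rel G := [rel x y | (x^-1 * y)%g \in A].

(* When A generates a subgroup H, the restriction of this function to H is the
   word metric of H: walks in the Cayley graph of G that start in H stay in H. *)
Definition word_dist (A : set G) : G -> G -> nat :=
  gdist (cayley (A `|` [set a^-1%g | a in A])).

Definition representatives (n : nat) (P : 'I_n -> set G) (C : set (set G)) :
    Prop :=
  (forall i, C (P i)) /\
  (forall Q, C Q -> exists! i, exists g : G, Q = [set (x ^ g)%g | x in P i]).

Definition rel_hyperbolic (n : nat) (P : 'I_n -> set G) : Prop :=
  [/\ countable [set: G],
      forall i, is_subgroup (P i)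
    & exists (K : graph) (a : graph_action G K),
      [/\ connected_graph (@adjacent K),
          exists delta, hyperbolic (@adjacent K) delta,
          fine K
        & [/\ forall e, finite_set (edge_stab a e),
              exists s : seq (dart K), forall e,
                exists g, exists2 f, f \in s & same_edge (actd a g f) e
            & representatives P
                [set Q | infinite_set Q /\ exists x, Q = vertex_stab a x]]]].

Definition peripheral (n : nat) (P : 'I_n -> set G) : set G :=
  (\bigcup_i P i) `\ 1%g.

Definition rel_generating (n : nat) (P : 'I_n -> set G) (S : set G) : Prop :=
  symmetric_set S /\ generated (S `|` \bigcup_i P i) = [set: G].

Local Open Scope ring_scope.

Definition is_metric (R : realType) (T : Type) (d : T -> T -> R) : Prop :=
  [/\ forall x y, d x y = 0 <-> x = y,
      forall x y, d x y = d y x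
    & forall x y z, d x z <= d x y + d y z].

Definition proper_metric (R : realType) (T : Type) (d : T -> T -> R) : Prop :=
  forall x r, finite_set [set y | d x y <= r].

Definition left_invariant (R : realType) (d : G -> G -> R) : Prop :=
  forall g x y, d (g * x)%g (g * y)%g = d x y.

Definition rel_quasiconvex (R : realType) (n : nat) (P : 'I_n -> set G)
    (H : set G) : Prop :=
  exists (S : set G) (d : G -> G -> R),
  [/\ finite_set S, rel_generating P S,
      [/\ is_metric d, proper_metric d & left_invariant d]
    & exists kappa : R, forall x y p, H x -> H y ->
        geodesic (cayley (S `|` peripheral P)) x y p ->
        forall v, v \in x :: p -> exists2 h, H h & d v h <= kappa].

Definition qi_embedding (R : realType) (X Y : Type) (D : set X)
    (dX : X -> X -> R) (dY : Y -> Y -> R) (f : X -> Y) : Prop :=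
  exists l c : R, [/\ 1 <= l, 0 <= c
    & forall x y, D x -> D y ->
        l^-1 * dX x y - c <= dY (f x) (f y) <= l * dX x y + c].

Definition undistorted (R : realType) (H : set G) : Prop :=
  exists A B : set G,
  [/\ finite_set A, generated A = [set: G], finite_set B, generated B = H
    & qi_embedding H (fun x y => (word_dist B x y)%:R : R)
        (fun x y => (word_dist A x y)%:R : R) id].

End Groups.

(* Main.v *)
Require Import Defs.
From mathcomp Require Import all_boot all_order all_algebra.
From mathcomp Require Import boolp classical_sets cardinality reals.
From mathcomp Require Import zify.

(** Let A be a finite generating set of G with word metric dA, let S be a finite
    symmetric set containing the generators of G and of H, and let d1 be the
    metric of the relative Cayley graph, with edges labelled by S and by the
    peripheral elements.

    The theorem rests on a sharp form of hyperbolicity of the relative Cayley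
    graph ([rel_geodesics_thin]): in a triangle of d1-geodesics every vertex of one
    side is within a constant nu of another side, and this in the metric dA, not
    only in d1.  Fix v.  If the geodesic from x to z passes within nu k of v, then
    for every y the geodesic from x to y or the one from y to z passes within
    nu (k + 1) of v.  Now take a word in the generators of H from x to y, of
    minimal length.  Each of its steps is a d1-geodesic, so a step seen near v at
    scale k starts and ends at distance O(k) of v.  Splitting the word along a
    binary tree in which the i-th step, counted from the step closest to v, has
    depth O(log i) produces a step i at distance O(log i) from v.  Since H is
    undistorted that distance is also at least linear in i, up to a constant;
    hence i is bounded and the word, whose vertices lie in H, passes near v.  This
    is [near_of_split] together with [rel_geodesic_near_subgroup].

    To prove this sharp form, start with hyperbolicity in the metric d1.  The map
    sending g to g v0 is a quasi-isometric embedding of the relative Cayley graph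
    in the fine graph K ([rel_dist_up], [rel_dist_low]), and hyperbolicity passes
    through it by stability of quasi-geodesics; the latter is another instance of
    [near_of_split], with balls of K in place of balls of dA
    ([thin_of_quasi_isometry]).

    To replace d1 by dA one uses the coned-off graph, whose vertices are the
    elements of G and one cone vertex g w_i for each peripheral coset g P_i.
    Fineness of K implies that a circuit of bounded length in the coned-off graph
    has bounded dA-diameter ([coned_fine]): a circuit visits a cone vertex once,
    so in K it gives a closed path whose only possibly wild passage at that
    vertex is the one between the two group elements next to it, and the other
    passages together with the circuits of K between them bound this one.  In a
    geodesic triangle, take the edge following v on its side and go around: along
    the side for a bounded time, across to the other two sides, and back.  The
    crossings are far from v, so a circuit through this edge in the resulting
    bounded loop has to use the other two sides ([circuit_meets_side]), and it
    has bounded dA-diameter ([thin_in_fine_metric]). *)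

Set Implicit Arguments.
Unset Strict Implicit.
Unset Printing Implicit Defensive.

(** * Discrete geodesics and geodesic splitting *)

Section GraphMetrics.
Variable X : Type.
Implicit Types (d : X -> X -> nat) (c : nat -> X).

Definition geo d c m := forall i j, i <= j <= m -> d (c i) (c j) = j - i.

(** In a graph metric: u lies on some geodesic from x to y. *)
Definition btw d x u y := d x u + d u y = d x y.

Record graph_metric d : Prop := GraphMetric {
  gm_refl : forall x, d x x = 0;
  gm_eq : forall x y, d x y = 0 -> x = y;
  gm_sym : forall x y, d x y = d y x;
  gm_tri : forall x y z, d x z <= d x y + d y z;
  gm_geo : forall x y, exists c, [/\ c 0 = x, c (d x y) = y & geo d c (d x y)]
}.

Lemma geo_rev d c m : graph_metric d -> geo d c m -> geo d (fun i => c (m - i)) m.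
Proof. by move=> gd gc i j ij; rewrite gm_sym // gc; lia. Qed.

Lemma geo_btw d c m i : geo d c m -> i <= m -> btw d (c 0) (c i) (c m).
Proof. by move=> gc im; rewrite /btw !gc; lia. Qed.

(** Concatenate geodesics from x to v and from v to z: a shortcut between two points
    of the result would bring x closer to z. *)
Lemma geo_through d x v z : graph_metric d -> btw d x v z ->
  exists c, [/\ c 0 = x, c (d x v) = v, c (d x z) = z & geo d c (d x z)].
Proof.
move=> gd b; rewrite /btw in b.
have [c1 [c10 c1v g1]] := gm_geo gd x v.
have [c2 [c20 c2z g2]] := gm_geo gd v z.
pose c i := if i <= d x v then c1 i else c2 (i - d x v).
have cz : c (d x z) = z.
  rewrite /c; case: ifP => h; last by rewrite -b addKn.
  have e : d x z = d x v by lia.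
  by rewrite e c1v; apply: (gm_eq gd); lia.
exists c; split=> //; rewrite /c ?leqnn //=.
move=> i j /andP[ij jm]; case: ifP => hi; case: ifP => hj; try lia.
- by rewrite g1 //; lia.
- have h1 : d (c1 i) (c1 (d x v)) = d x v - i by rewrite g1 //; lia.
  have h2 : d (c2 0) (c2 (j - d x v)) = j - d x v - 0 by rewrite g2 //; lia.
  have h3 : d (c1 0) (c1 i) = i - 0 by rewrite g1 //; lia.
  have h4 : d (c2 (j - d x v)) (c2 (d v z)) = d v z - (j - d x v).
    by rewrite g2 //; lia.
  rewrite c1v in h1; rewrite c20 in h2; rewrite c10 in h3; rewrite c2z in h4.
  have := gm_tri gd (c1 i) v (c2 (j - d x v)).
  have := gm_tri gd x (c1 i) z.
  have := gm_tri gd (c1 i) (c2 (j - d x v)) z.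
  by lia.
- by rewrite g2 //; lia.
Qed.

(** The Rips condition when only the vertices lying on some geodesic between two
    points are seen. *)
Definition slim d delta := forall x y z v, btw d x v z ->
  exists2 w, btw d x w y \/ btw d y w z & d v w <= delta.

(** Unlike in [slim], the two geodesics issued from the common vertex are
    prescribed. *)
Definition thin d delta := forall q r m1 m2 v, geo d q m1 -> geo d r m2 ->
  q 0 = r 0 -> btw d (q m1) v (r m2) ->
  (exists2 i, i <= m1 & d v (q i) <= delta) \/
  (exists2 i, i <= m2 & d v (r i) <= delta).

End GraphMetrics.

Section DyadicSplitting.
Variables (X : Type) (B : nat -> X -> X -> Prop).
Hypothesis B_mono : forall n x y, B n x y -> B n.+1 x y.
Hypothesis B_split : forall n x y z, B n x z -> B n.+1 x y \/ B n.+1 y z.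

Let B_monoD n k x y : B n x y -> B (n + k) x y.
Proof. by elim: k => [|k IH] b; rewrite ?addn0 // addnS; apply/B_mono/IH. Qed.

(** A balanced binary tree with at most 2 ^ m leaves has depth m. *)
Lemma halving (x : nat -> X) m n i l : 0 < l <= 2 ^ m -> B n (x i) (x (i + l)) ->
  exists2 k, i <= k < i + l & B (n + m) (x k) (x k.+1).
Proof.
elim: m n i l => [|m IH] n i l.
  rewrite expn0 => l1 b; have ? : l = 1 by lia.
  by subst l; exists i; [lia | rewrite addn0 -addn1].
move=> l2 b; have [lm|lm] := leqP l (2 ^ m).
  have [|k kl bk] := IH n i l _ b; first lia.
  by exists k => //; rewrite addnS; apply: B_mono.
rewrite expnS in l2.
have [b1|b1] := B_split (x (i + 2 ^ m)) b.
  have [|k kl bk] := IH _ _ _ _ b1; first lia.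
  by exists k; [lia | rewrite addnS -addSn].
have b2 : B n.+1 (x (i + 2 ^ m)) (x (i + 2 ^ m + (l - 2 ^ m))).
  by have -> : i + 2 ^ m + (l - 2 ^ m) = i + l by lia.
have [|k kl bk] := IH _ _ _ _ b2; first lia.
by exists k; [lia | rewrite addnS -addSn].
Qed.

(** Cut first at 1, then at 3, at 7, and so on: the m-th block has 2 ^ m steps and
    is reached after m cuts, and halving it costs m more.  So the step number i is
    reached at a depth of about 2 log i, whatever the length of the sequence. *)
Lemma dyadic_splitting (x : nat -> X) n l : 0 < l -> B n (x 0) (x l) ->
  exists m i, [/\ i < l, 2 ^ m <= i.+1 & B (n + m.*2.+1) (x i) (x i.+1)].
Proof.
move=> l0 b.
suff gen f m : l <= f + m -> 2 ^ m <= l -> B (n + m) (x (2 ^ m).-1) (x l) ->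
    exists m i, [/\ i < l, 2 ^ m <= i.+1 & B (n + m.*2.+1) (x i) (x i.+1)].
  by apply: (gen l 0); rewrite ?addn0.
elim: f m => [|f IH] m fm lm {}b; first by have := ltn_expl m (ltnSn 1); lia.
have pm : 0 < 2 ^ m by rewrite expn_gt0.
have em : 2 ^ m.+1 = 2 ^ m + 2 ^ m by rewrite expnS; lia.
have close l' n' : 2 ^ m <= l' <= l -> l' < 2 ^ m.+1 -> n' + m <= n + m.*2.+1 ->
    B n' (x (2 ^ m).-1) (x l') ->
    exists m i, [/\ i < l, 2 ^ m <= i.+1 & B (n + m.*2.+1) (x i) (x i.+1)].
  move=> l1 l2 nn b'.
  have e : l' = (2 ^ m).-1 + (l' - (2 ^ m).-1) by lia.
  rewrite e in b'.
  have [|k kl bk] := halving (m := m) _ b'; first lia.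
  exists m, k; split; try lia.
  have -> : n + m.*2.+1 = n' + m + (n + m.*2.+1 - (n' + m)) by lia.
  exact: B_monoD.
have [lt|ge] := ltnP l (2 ^ m.+1); first by apply: (close l (n + m)) => //; lia.
have [b1|b1] := B_split (x (2 ^ m.+1).-1) b.
  by apply: (close (2 ^ m.+1).-1 (n + m).+1) => //; lia.
by apply: (IH m.+1) => //; [lia | rewrite addnS].
Qed.

End DyadicSplitting.

Lemma expn_beats_linear a b : exists M, forall m, 2 ^ m <= a * m + b -> m <= M.
Proof.
exists (4 * a + 2 * b + 4) => m; apply: contraTT; rewrite -!ltnNge => h.
have e : m./2 + uphalf m = m by rewrite addnC uphalf_half; have := odd_double_half m; lia.
have h1 := ltn_expl (m./2) (ltnSn 1); have h2 := ltn_expl (uphalf m) (ltnSn 1).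
have h3 : (m./2).+1 * (uphalf m).+1 <= 2 ^ m by rewrite -{3}e expnD leq_mul.
have u2 : m <= (uphalf m).*2 by rewrite uphalf_half; have := odd_double_half m; lia.
apply: leq_trans h3.
have : 2 * a + b + 1 <= m./2 by have := odd_double_half m; lia.
by nia.
Qed.

(** Stability of quasi-geodesics in abstract form: [B n x y] means that a geodesic
    from x to y passes at scale n from a fixed point, and [rho] is the distance to
    that point.  Counting indices from the term x_c closest to the point, the
    dyadic splitting of one half of the sequence yields a step i with
    rho (x_i) = O(log i); but i = O(rho (x_i)) because rho (x_c) is at most
    rho (x_i). *)
Lemma near_of_split C lam : exists D, forall (X : Type) (B : nat -> X -> X -> Prop)
    (rho : X -> nat) (x : nat -> X) m,
  (forall n x y, B n x y -> B n.+1 x y) ->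
  (forall n x y z, B n x z -> B n.+1 x y \/ B n.+1 y z) ->
  (forall n i, i < m -> B n (x i) (x i.+1) ->
     rho (x i) <= C * n.+1 /\ rho (x i.+1) <= C * n.+1) ->
  (forall i j, i <= j <= m -> j - i <= lam * (rho (x i) + rho (x j)).+1) ->
  0 < m -> B 0 (x 0) (x m) ->
  exists2 i, i <= m & rho (x i) <= D.
Proof.
have [M HM] := expn_beats_linear (4 * lam * C) (6 * lam * C + lam + 1).
exists (C * (2 * M + 3)) => X B rho x m mono split step sep m0 b.
have [c cm cmin] : exists2 c, c <= m & forall i, i <= m -> rho (x c) <= rho (x i).
  have ex : exists r, `[< exists2 i, i <= m & rho (x i) = r >].
    by exists (rho (x 0)); apply/asboolP; exists 0.
  have [r /asboolP[c cm <-] rmin] := ex_minnP ex.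
  by exists c => // i im; apply: rmin; apply/asboolP; exists i.
have wide k i : k <= m -> (i = k - c \/ i = c - k) -> i <= lam * (2 * rho (x k)).+1.
  move=> km ik; have r := cmin k km.
  have le : lam * (rho (x c) + rho (x k)).+1 <= lam * (2 * rho (x k)).+1.
    by rewrite leq_mul2l; lia.
  have := sep c k; have := sep k c; rewrite (addnC (rho (x k))); lia.
have settle k n' i : k <= m -> 2 ^ n' <= i.+1 -> (i = k - c \/ i = c - k) ->
    rho (x k) <= C * (1 + n'.*2.+1).+1 -> rho (x k) <= C * (2 * M + 3).
  move=> km ni ik r; have w := wide k i km ik.
  suff n'M : n' <= M by apply: leq_trans r _; rewrite leq_mul2l; lia.
  apply: HM; apply: leq_trans ni _.
  have : lam * (2 * rho (x k)).+1 <= lam * (2 * (C * (1 + n'.*2.+1).+1)).+1.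
    by rewrite leq_mul2l; lia.
  by nia.
have forward : c < m -> B 1 (x c) (x m) -> rho (x c) <= C * (2 * M + 3).
  move=> cm' b1; have b1' : B 1 (x (c + 0)) (x (c + (m - c))).
    by rewrite addn0 subnKC.
  have [|n' [i [il ni]]] := dyadic_splitting mono split (x := fun i => x (c + i)) _ b1'.
    by lia.
  rewrite (addnS c) => bi; have [|r _] := step _ _ _ bi; first lia.
  by apply: leq_trans (cmin (c + i) _) _; [lia | apply: settle ni _ r; lia].
have backward : 0 < c -> B 1 (x 0) (x c) -> rho (x c) <= C * (2 * M + 3).
  move=> c0 b1; pose B' n y z := B n z y.
  have mono' n y z : B' n y z -> B' n.+1 y z by apply: mono.
  have split' n y z t : B' n y t -> B' n.+1 y z \/ B' n.+1 z t.
    by move=> /(split _ _ z _)[]; [right | left].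
  have b1' : B' 1 (x (c - 0)) (x (c - c)) by rewrite subn0 subnn.
  have [n' [i [il ni]]] := dyadic_splitting mono' split' (x := fun i => x (c - i)) c0 b1'.
  have e : c - i = (c - i.+1).+1 by lia.
  rewrite /B' e => bi; have [|_ r] := step _ _ _ bi; first lia.
  rewrite -e in r.
  by apply: leq_trans (cmin (c - i) _) _; [lia | apply: settle ni _ r; lia].
exists c => //; have [c0|c0] := posnP c.
  by apply: forward; [lia | rewrite c0; apply: mono].
have [cm'|cm'] := ltnP c m; last first.
  have e : c = m by lia.
  by apply: backward => //; rewrite e; apply: mono.
by have [|] := split _ _ (x c) _ b; [apply: backward | apply: forward].
Qed.

(** * Hyperbolicity under quasi-isometries *)

Section QuasiIsometry.
Variables (X Y : Type) (d1 : X -> X -> nat) (d2 : Y -> Y -> nat).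
Variables (phi : X -> Y) (L delta : nat).
Hypotheses (gm1 : graph_metric d1) (gm2 : graph_metric d2).
Hypothesis phi_up : forall g h, d2 (phi g) (phi h) <= L * d1 g h.
Hypothesis phi_low : forall g h, d1 g h <= L * (d2 (phi g) (phi h)).+1.
Hypothesis slim2 : slim d2 delta.

(** First half of the Morse lemma: here [B n x y] says that some geodesic from x
    to y meets the ball of radius delta n around t. *)
Lemma geodesic_near_image : exists D, forall c m t, geo d1 c m ->
  btw d2 (phi (c 0)) t (phi (c m)) -> exists2 i, i <= m & d2 t (phi (c i)) <= D.
Proof.
have [D HD] := near_of_split (delta + L) L.
exists D => c m t gc bt; have [m0|m0] := posnP m.
  exists 0 => //; move: bt; rewrite /btw m0 (gm_refl gm2).
  by have := gm_sym gm2 t (phi (c 0)); lia.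
pose B n x y := exists2 u, btw d2 x u y & d2 u t <= delta * n.
have [||||||i im ri] := HD _ B (fun y => d2 y t) (fun i => phi (c i)) m.
- by move=> n x y [u ? ut]; exists u => //; apply: leq_trans ut _; rewrite leq_mul2l; lia.
- move=> n x y z [u b ut]; have [w bw uw] := slim2 y b.
  have wt : d2 w t <= delta * n.+1.
    by have := gm_tri gm2 w u t; have := gm_sym gm2 w u; lia.
  by case: bw => bw; [left | right]; exists w.
- move=> n i im [u bu ut]; have := phi_up (c i) (c i.+1).
  rewrite gc; last by lia.
  move: bu; rewrite /btw subSn // subnn muln1 => bu le.
  have h1 := gm_tri gm2 (phi (c i)) u t.
  have h2 := gm_tri gm2 (phi (c i.+1)) u t.
  have h3 := gm_sym gm2 u (phi (c i.+1)).
  have : L <= L * n.+1 by rewrite leq_pmulr.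
  by rewrite !mulnDl !mulnS in ut *; lia.
- move=> i j ij; rewrite -gc //; apply: leq_trans (phi_low _ _) _.
  rewrite leq_mul2l; have := gm_tri gm2 (phi (c i)) t (phi (c j)).
  by have := gm_sym gm2 t (phi (c j)); lia.
- exact: m0.
- by exists t => //; rewrite gm_refl.
- by exists i => //; rewrite gm_sym.
Qed.

(** Second half of the Morse lemma: by the first half, the points of a geodesic of
    Y are close to image points of index less than j, then to image points of index
    at least j; where this changes, the two indices are close to each other, hence
    to j. *)
Lemma image_near_geodesic : exists D, forall c m j, geo d1 c m -> j <= m ->
  exists2 t, btw d2 (phi (c 0)) t (phi (c m)) & d2 (phi (c j)) t <= D.
Proof.
have [D HD] := geodesic_near_image.
exists (L * (L * (2 * D + 2)) + D) => c m j gc jm.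
set M := d2 (phi (c 0)) (phi (c m)).
have [e [e0 eM ge]] := gm_geo gm2 (phi (c 0)) (phi (c m)).
have be k : k <= M -> btw d2 (phi (c 0)) (e k) (phi (c m)).
  by move=> kM; rewrite -{1}e0 -eM; apply: geo_btw.
pose late k := `[< k <= M /\ exists2 i, j <= i <= m & d2 (e k) (phi (c i)) <= D >].
have ex : exists k, late k.
  exists M; apply/asboolP; split=> //; exists m; first by rewrite jm leqnn.
  by rewrite /M eM (gm_refl gm2).
have [k /asboolP[kM [i ij ki]] kmin] := ex_minnP ex.
exists (e k); first exact: be.
suff [i' i'j ii'] : exists2 i', i' <= j & i - i' <= L * (2 * D + 2).
  have h1 := phi_up (c j) (c i); rewrite gc // in h1.
  have h2 : L * (i - j) <= L * (L * (2 * D + 2)) by rewrite leq_mul2l; lia.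
  have := gm_tri gm2 (phi (c j)) (phi (c i)) (e k).
  by have := gm_sym gm2 (phi (c i)) (e k); lia.
have low i' n : i' <= i -> d2 (phi (c i')) (phi (c i)) <= n -> i - i' <= L * n.+1.
  move=> ii' le; rewrite -gc; last by lia.
  by apply: leq_trans (phi_low _ _) _; rewrite leq_mul2l; lia.
case: k => [|k] in kM ki kmin *.
  exists 0 => //; rewrite e0 in ki; have := low 0 D isT ki.
  have : L * D.+1 <= L * (2 * D + 2) by rewrite leq_mul2l; lia.
  by lia.
have [i' i'm ki'] := HD c m (e k) gc (be k (ltnW kM)).
have i'j : i' < j.
  rewrite ltnNge; apply/negP => ji'; have : late k.
    by apply/asboolP; split; [lia | exists i' => //; rewrite ji'].
  by move=> /kmin; lia.
exists i'; first lia.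
have := low i' (2 * D + 1); rewrite addn1 addn2; apply; first lia.
have step : d2 (e k) (e k.+1) = k.+1 - k by apply: ge; lia.
have := gm_tri gm2 (phi (c i')) (e k) (phi (c i)).
have := gm_tri gm2 (e k) (e k.+1) (phi (c i)).
by have := gm_sym gm2 (phi (c i')) (e k); lia.
Qed.

Lemma thin_of_quasi_isometry : exists delta', thin d1 delta'.
Proof.
have [D1 H1] := geodesic_near_image; have [D2 H2] := image_near_geodesic.
exists (L * (D2 + delta + D1).+1) => q r m1 m2 v gq gr qr bv.
have [c [c0 cj cm gc]] := geo_through gm1 bv.
have jm : d1 (q m1) v <= d1 (q m1) (r m2) by rewrite -bv leq_addr.
have [t bt vt] := H2 _ _ _ gc jm.
rewrite cj in vt; rewrite c0 cm in bt.
have [w bw tw] := slim2 (phi (q 0)) bt.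
have close u : d2 w (phi u) <= D1 -> d1 v u <= L * (D2 + delta + D1).+1.
  move=> wu; apply: leq_trans (phi_low _ _) _; rewrite leq_mul2l.
  have := gm_tri gm2 (phi v) t (phi u).
  by have := gm_tri gm2 t w (phi u); lia.
case: bw => bw.
  have bw' : btw d2 (phi (q (m1 - 0))) w (phi (q (m1 - m1))).
    by rewrite subn0 subnn.
  have [i im wi] := H1 _ _ _ (geo_rev gm1 gq) bw'.
  by left; exists (m1 - i); [lia | apply: close].
have bw' : btw d2 (phi (r 0)) w (phi (r m2)) by rewrite -qr.
have [i im wi] := H1 _ _ _ gr bw'.
by right; exists i => //; apply: close.
Qed.

End QuasiIsometry.

(** * The edge metric of a graph *)

Section EdgeMetric.
Variables (V : eqType) (adj : rel V).

Lemma gdistP x y : (exists p, walk adj x y p) ->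
  (exists2 p, walk adj x y p & size p = gdist adj x y) /\
  (forall q, walk adj x y q -> gdist adj x y <= size q).
Proof.
move=> [p wp]; rewrite /gdist; set P := (X in xget 0 X).
suff : P (xget 0 P) by [].
apply: xgetPex.
have ex : exists n, `[< exists2 p, walk adj x y p & size p = n >].
  by exists (size p); apply/asboolP; exists p.
have [n /asboolP hn nmin] := ex_minnP ex.
by exists n; split=> // q wq; apply: nmin; apply/asboolP; exists q.
Qed.

Lemma gdist_le x y q : walk adj x y q -> gdist adj x y <= size q.
Proof. by move=> wq; have [_] := gdistP (ex_intro _ q wq); apply. Qed.

Lemma walk_cat x y z p q : walk adj x y p -> walk adj y z q -> walk adj x z (p ++ q).
Proof.
by move=> [pp <-] [pq <-]; split; rewrite ?cat_path ?pp // last_cat.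
Qed.

Lemma gdist_tri x y z : (exists p, walk adj x y p) -> (exists p, walk adj y z p) ->
  gdist adj x z <= gdist adj x y + gdist adj y z.
Proof.
move=> /gdistP[[p wp <-] _] /gdistP[[q wq <-] _].
by rewrite -size_cat; apply: gdist_le; apply: walk_cat wp wq.
Qed.

Lemma gdist_refl x : gdist adj x x = 0.
Proof. by apply/eqP; rewrite -leqn0; apply: (@gdist_le _ _ [::]). Qed.

Lemma gdist1 x y : adj x y -> gdist adj x y <= 1.
Proof. by move=> xy; apply: (@gdist_le _ _ [:: y]); rewrite /walk /= xy. Qed.

Lemma gdist_eq x y : (exists p, walk adj x y p) -> gdist adj x y = 0 -> x = y.
Proof. by move=> /gdistP[[p [_ lp] sp] _] d0; move: lp; rewrite d0 in sp; case: p sp. Qed.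

Lemma walk_of_fun (c : nat -> V) i l :
  (forall k, i <= k < i + l -> adj (c k) (c k.+1)) ->
  walk adj (c i) (c (i + l)) [seq c k.+1 | k <- iota i l].
Proof.
elim: l i => [|l IH] i h; first by rewrite addn0.
have [|p1 p2] := IH i.+1; first by move=> k kl; apply: h; lia.
by split=> /=; rewrite ?p1 ?p2 ?addSnnS // h //; lia.
Qed.

Lemma gdist_fun_le (c : nat -> V) i l :
  (forall k, i <= k < i + l -> adj (c k) (c k.+1)) -> gdist adj (c i) (c (i + l)) <= l.
Proof. by move=> /walk_of_fun/gdist_le; rewrite size_map size_iota. Qed.

(** Geodesics as functions of their length parameter; connectedness of the two
    points suffices, so that this also applies to the Cayley graph of a subgroup. *)
Lemma geodesic_fun x y : (exists p, walk adj x y p) ->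
  exists c, [/\ c 0 = x, c (gdist adj x y) = y,
    forall i, i < gdist adj x y -> adj (c i) (c i.+1) &
    geo (gdist adj) c (gdist adj x y)].
Proof.
move=> /gdistP[[p [pp lp] sp] min].
pose c i := nth x (x :: p) i; set m := gdist adj x y in sp min *.
have cadj i : i < m -> adj (c i) (c i.+1).
  by rewrite -sp => im; apply: (pathP x pp).
have cm : c m = y by rewrite /c -sp -last_nth.
have w i j : i <= j <= m -> exists p, walk adj (c i) (c j) p.
  move=> ij; have := @walk_of_fun c i (j - i); rewrite subnKC; last by lia.
  by move=> h; eexists; apply: h => k kl; apply: cadj; lia.
have up i j : i <= j <= m -> gdist adj (c i) (c j) <= j - i.
  move=> ij; have := @gdist_fun_le c i (j - i); rewrite subnKC; last by lia.
  by apply=> k kl; apply: cadj; lia.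
exists c; split=> // i j ij; apply/eqP; rewrite eqn_leq up //=.
have h1 := @gdist_tri _ _ _ (w 0 i ltac:(lia)) (w i m ltac:(lia)).
have h2 := @gdist_tri _ _ _ (w i j ltac:(lia)) (w j m ltac:(lia)).
have h3 := up 0 i ltac:(lia); have h4 := up j m ltac:(lia).
by rewrite cm {1}/c /= -/m in h1 h2 h4; lia.
Qed.

Hypothesis adj_sym : symmetric adj.

Lemma walk_sym x y : (exists p, walk adj x y p) -> exists p, walk adj y x p.
Proof.
move=> [p [pp <-]]; exists (rev (belast x p)); split.
  by rewrite rev_path (eq_path (e' := adj)).
by case: p pp => //= a p _; rewrite rev_cons last_rcons.
Qed.

Lemma gdist_sym x y : (exists p, walk adj x y p) -> gdist adj x y = gdist adj y x.
Proof.
suff le x' y' : (exists p, walk adj x' y' p) -> gdist adj y' x' <= gdist adj x' y'.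
  by move=> h; apply/eqP; rewrite eqn_leq !le //; apply: walk_sym.
move=> /gdistP[[p [pp lp] <-] _]; rewrite -(size_belast x') -size_rev -lp.
apply: gdist_le; split; first by rewrite rev_path (eq_path (e' := adj)).
by case: p pp {lp} => //= a p _; rewrite rev_cons last_rcons.
Qed.

Hypothesis conn : forall x y, exists p, walk adj x y p.

Lemma gdist_metric : graph_metric (gdist adj).
Proof.
split.
- exact: gdist_refl.
- by move=> x y; apply: gdist_eq.
- by move=> x y; apply: gdist_sym.
- by move=> x y z; apply: gdist_tri.
- by move=> x y; have [c [? ? _ ?]] := geodesic_fun (conn x y); exists c.
Qed.

Lemma geodesic_btw x y p w : geodesic adj x y p -> w \in x :: p ->
  btw (gdist adj) x w y.
Proof.
move=> [[pp lp] sp] /splitPl E; case: E pp lp sp => p1 p2 e.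
rewrite cat_path last_cat size_cat e => /andP[h1 h2] h3 h4.
apply/eqP; rewrite eqn_leq gdist_tri // -h4 leq_add //; exact: gdist_le.
Qed.

Lemma slim_of_hyperbolic delta : hyperbolic adj delta -> slim (gdist adj) delta.
Proof.
move=> hyp x y z v bv.
have [[p1 w1 s1] _] := gdistP (conn x v); have [[p2 w2 s2] _] := gdistP (conn v z).
have [[p wp sp] _] := gdistP (conn x y); have [[q wq sq] _] := gdistP (conn y z).
have gr : geodesic adj x z (p1 ++ p2).
  by split; [apply: walk_cat w1 w2 | rewrite size_cat s1 s2].
have vr : v \in x :: (p1 ++ p2).
  by case: w1 => _ <-; rewrite -cat_cons mem_cat mem_last.
have [w] := hyp _ _ _ _ _ _ (conj wp sp) (conj wq sq) gr v vr.
rewrite mem_cat => /orP wpq le; exists w => //.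
by case: wpq => h; [left | right]; [apply: geodesic_btw h | apply: geodesic_btw h].
Qed.

End EdgeMetric.

(** * Bounded connections in a graph *)

Section Reach.
Variables (V : eqType) (E : rel V).
Hypothesis E_sym : symmetric E.

(** A walk is required because [gdist] is 0 on disconnected pairs. *)
Definition reach N x y := (exists p, walk E x y p) /\ gdist E x y <= N.

Lemma reach_refl N x : reach N x x.
Proof. by split; [exists [::] | rewrite gdist_refl]. Qed.

Lemma reach1 x y : E x y -> reach 1 x y.
Proof.
by move=> xy; split; [exists [:: y]; rewrite /walk /= xy | apply: gdist1].
Qed.

Lemma reach_trans N N' x y z : reach N x y -> reach N' y z -> reach (N + N') x z.
Proof.
move=> [[p wp] le] [[q wq] le']; split; first by exists (p ++ q); apply: walk_cat wq.
by apply: leq_trans (leq_add le le'); apply: gdist_tri; [exists p | exists q].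
Qed.

Lemma reach_sym N x y : reach N x y -> reach N y x.
Proof. by move=> [ex le]; split; [apply: walk_sym | rewrite -gdist_sym]. Qed.

Lemma reach_le N N' x y : N <= N' -> reach N x y -> reach N' x y.
Proof. by move=> NN' [ex le]; split=> //; apply: leq_trans NN'. Qed.

Lemma reach_fun N (c : nat -> V) i l :
  (forall k, i <= k < i + l -> reach N (c k) (c k.+1)) -> reach (N * l) (c i) (c (i + l)).
Proof.
elim: l => [|l IH] h; first by rewrite addn0; apply: reach_refl.
rewrite mulnS addnC addnS; apply: (@reach_trans _ _ _ (c (i + l))).
  by apply: IH => k kl; apply: h; lia.
by apply: h; lia.
Qed.

Lemma reach_uniq N x y : reach N x y ->
  exists p, [/\ path E x p, last x p = y, uniq (x :: p) & size p <= N].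
Proof.
move=> [ex le]; have [[p [pp lp] sp] _] := gdistP ex.
rewrite -sp in le; move: lp; case/shortenP: pp => p' pp' un sub lp; exists p'; split=> //.
apply: leq_trans le; apply: uniq_leq_size => //.
by case/andP: un.
Qed.

End Reach.

(** * Crossing from one side of a triangle to the others *)

(** [d1] stands for the relative metric on G and [adj] for the adjacency of the
    coned-off graph, with cone vertices in V. *)
Section ConedRegions.
Variables (G V : eqType) (d1 : G -> G -> nat) (adj : rel (G + V)) (delta : nat).
Hypotheses (gm1 : graph_metric d1) (thin1 : thin d1 delta).
Hypothesis adj_sym : symmetric adj.
Hypothesis adj_edge : forall g h, d1 g h = 1 -> adj (inl g) (inl h) \/
  exists2 x, adj (inl g) (inr x) & adj (inr x) (inl h).
Hypothesis adj_cone : forall g h x, adj (inl g) (inr x) -> adj (inl h) (inr x) ->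
  d1 g h <= 1.

Section Regions.
Variables (a : G) (T0 : nat) (side : G -> Prop).

(** The geodesic under study leaves a, and v is its point at distance T0 from a.
    Cone vertices are put in a region according to their neighbours; the gap between
    T0 < d1 and d1 < T0 is what keeps the two regions disjoint there, since two
    neighbours of a cone vertex are at distance at most 1. *)
Definition far_region (u : G + V) : Prop := match u with
  | inl g => T0 < d1 a g
  | inr x => exists2 g, adj (inl g) (inr x) & T0 < d1 a g end.

Definition near_region (u : G + V) : Prop := match u with
  | inl g => d1 a g <= T0
  | inr x => exists2 g, adj (inl g) (inr x) & d1 a g < T0 end.

Definition on_side (u : G + V) : Prop := if u is inl g then side g else False.

(** An edge may pass from the near to the far region only at a vertex of the other
    two sides of the triangle. *)
Definition region_edge : rel (G + V) := fun u u' => adj u u' &&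
  `[< (far_region u /\ far_region u') \/ (near_region u /\ near_region u') \/
      (on_side u \/ on_side u') >].

Lemma region_edge_sym : symmetric region_edge.
Proof.
move=> u u'; rewrite /region_edge adj_sym; congr (_ && _).
by apply/asboolP/asboolP; tauto.
Qed.

Lemma regions_disjoint u : far_region u -> near_region u -> False.
Proof.
case: u => [g|x] /=; first by lia.
move=> [g gx fg] [h hx nh]; have := adj_cone gx hx.
by have := gm_tri gm1 a h g; have := gm_sym gm1 h g; lia.
Qed.

Lemma reach_far g h : d1 g h = 1 -> T0 < d1 a g -> T0 < d1 a h ->
  reach region_edge 2 (inl g) (inl h).
Proof.
move=> gh fg fh; case: (adj_edge gh) => [e|[x gx xh]].
  apply: (@reach_le _ _ 1) => //; apply: reach1.
  by rewrite /region_edge e; apply/asboolP; left.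
apply: (@reach_trans _ _ 1 1 _ (inr x)); apply: reach1.
  by rewrite /region_edge gx; apply/asboolP; left; split=> //=; exists g.
by rewrite /region_edge xh; apply/asboolP; left; split=> //=; exists g.
Qed.

Lemma reach_near g h : d1 g h = 1 -> d1 a g < T0 -> d1 a h <= T0 ->
  reach region_edge 2 (inl g) (inl h).
Proof.
move=> gh fg fh; have fg' := ltnW fg; case: (adj_edge gh) => [e|[x gx xh]].
  apply: (@reach_le _ _ 1) => //; apply: reach1.
  by rewrite /region_edge e; apply/asboolP; right; left.
apply: (@reach_trans _ _ 1 1 _ (inr x)); apply: reach1.
  by rewrite /region_edge gx; apply/asboolP; right; left; split=> //=; exists g.
by rewrite /region_edge xh; apply/asboolP; right; left; split=> //=; exists g.
Qed.

Lemma reach_side g h : d1 g h = 1 -> side g -> side h ->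
  reach region_edge 2 (inl g) (inl h).
Proof.
move=> gh fg fh; case: (adj_edge gh) => [e|[x gx xh]].
  apply: (@reach_le _ _ 1) => //; apply: reach1.
  by rewrite /region_edge e; apply/asboolP; right; right; left.
apply: (@reach_trans _ _ 1 1 _ (inr x)); apply: reach1.
  by rewrite /region_edge gx; apply/asboolP; right; right; left.
by rewrite /region_edge xh; apply/asboolP; right; right; right.
Qed.

Lemma reach_geo (c : nat -> G) i l m : geo d1 c m -> i + l <= m ->
  (forall k, i <= k < i + l -> d1 (c k) (c k.+1) = 1 ->
     reach region_edge 2 (inl (c k)) (inl (c k.+1))) ->
  reach region_edge (2 * l) (inl (c i)) (inl (c (i + l))).
Proof.
move=> gc il h; apply: (@reach_fun _ _ 2 (fun k => inl (c k))) => k kl.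
by apply: h => //; rewrite gc; lia.
Qed.

Lemma reach_far_btw g h : (forall u, btw d1 g u h -> T0 < d1 a u) ->
  reach region_edge (2 * d1 g h) (inl g) (inl h).
Proof.
move=> far; have [c [c0 cm gc]] := gm_geo gm1 g h.
have fc k : k <= d1 g h -> T0 < d1 a (c k).
  by move=> km; apply: far; have := geo_btw gc km; rewrite c0 cm.
have := @reach_geo c 0 (d1 g h) _ gc; rewrite add0n c0 cm; apply=> // k kl e.
by apply: reach_far => //; apply: fc; lia.
Qed.

Lemma reach_near_from t : d1 a t <= T0 -> reach region_edge (2 * d1 a t) (inl a) (inl t).
Proof.
move=> at0; have [c [c0 cm gc]] := gm_geo gm1 a t.
have fc k : k <= d1 a t -> d1 a (c k) = k.
  by move=> km; rewrite -c0 gc // subn0.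
have := @reach_geo c 0 (d1 a t) _ gc; rewrite add0n c0 cm; apply=> // k kl e.
by apply: reach_near => //; rewrite fc; lia.
Qed.

Lemma reach_side_geo (s : nat -> G) m i j : geo d1 s m -> (forall k, k <= m -> side (s k)) ->
  i <= j <= m -> reach region_edge (2 * (j - i)) (inl (s i)) (inl (s j)).
Proof.
move=> gs ss ij; have := @reach_geo s i (j - i) m gs; rewrite subnKC; last by lia.
by apply=> [|k kl e]; [lia | apply: reach_side => //; apply: ss; lia].
Qed.

(** The other two sides start at a common point y which may be very far.  If so, a
    shortcut is made at distance M before y: the triangle with vertices s1 i, s2 k
    and y is thin and its short side is too far to be the close one, so the shortcut
    joins s1 to s2.  It lies in the far region because M is large. *)
Lemma reach_detour (s1 s2 : nat -> G) n1 n2 i k D0 M :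
  geo d1 s1 n1 -> geo d1 s2 n2 -> s1 0 = s2 0 ->
  (forall k, k <= n1 -> side (s1 k)) -> (forall k, k <= n2 -> side (s2 k)) ->
  i <= n1 -> k <= n2 -> d1 (s1 i) (s2 k) <= D0 -> d1 a (s1 i) <= delta ->
  T0 + 2 * delta < M -> D0 + delta < M ->
  reach region_edge (2 * (2 * M + 2 * delta + D0)) (inl (s1 i)) (inl (s2 k)).
Proof.
move=> g1 g2 s12 ss1 ss2 i1 k2 ik ai TM DM.
have rs := reach_sym region_edge_sym.
have [iM|Mi] := leqP i M.
  have r1 := rs _ _ _ (reach_side_geo (i := 0) (j := i) g1 ss1 ltac:(lia)).
  have r2 := reach_side_geo (i := 0) (j := k) g2 ss2 ltac:(lia).
  rewrite -s12 in r2; apply: reach_le (reach_trans r1 r2).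
  have h1 : d1 (s1 0) (s1 i) = i - 0 by rewrite g1 //; lia.
  have h2 : d1 (s2 0) (s2 k) = k - 0 by rewrite g2 //; lia.
  by rewrite s12 in h1; have := gm_tri gm1 (s2 0) (s1 i) (s2 k); lia.
have vi : d1 (s1 i) (s1 (i - M)) = M by rewrite gm_sym // g1; lia.
have [e [e0 el ge]] := gm_geo gm1 (s2 k) (s1 i).
have gr : geo d1 (fun t => s2 (k - t)) k.
  by apply: geo_rev => // p q pq; apply: g2; lia.
have bv : btw d1 (e (d1 (s2 k) (s1 i))) (s1 (i - M)) (s2 (k - k)).
  rewrite el subnn -s12 /btw vi; have h : i <= n1 by [].
  have -> : d1 (s1 (i - M)) (s1 0) = i - M by rewrite gm_sym // g1; lia.
  have -> : d1 (s1 i) (s1 0) = i by rewrite gm_sym // g1; lia.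
  by lia.
have er : e 0 = s2 (k - 0) by rewrite subn0.
have [[t tl vt]|[t tk vt]] := thin1 ge gr er bv.
  have h1 : d1 (e t) (s1 i) <= D0.
    have := geo_btw ge tl; rewrite /btw e0 el.
    by have := gm_sym gm1 (s2 k) (s1 i); lia.
  have := gm_tri gm1 (s1 i) (e t) (s1 (i - M)).
  have := gm_sym gm1 (s1 i) (e t); have := gm_sym gm1 (s1 (i - M)) (e t); lia.
have r1 := rs _ _ _ (reach_side_geo (i := i - M) (j := i) g1 ss1 ltac:(lia)).
have r3 := reach_side_geo (i := k - t) (j := k) g2 ss2 ltac:(lia).
have r2 : reach region_edge (2 * d1 (s1 (i - M)) (s2 (k - t)))
    (inl (s1 (i - M))) (inl (s2 (k - t))).
  apply: reach_far_btw => u; rewrite /btw => bu.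
  have := gm_tri gm1 (s1 i) u (s1 (i - M)); have := gm_tri gm1 (s1 i) a u.
  by have := gm_sym gm1 (s1 i) a; have := gm_sym gm1 u (s1 (i - M)); lia.
apply: reach_le (reach_trans (reach_trans r1 r2) r3).
have h : d1 (s2 (k - t)) (s2 k) = k - (k - t) by rewrite g2 //; lia.
have := gm_tri gm1 (s2 (k - t)) (s1 (i - M)) (s2 k).
have := gm_tri gm1 (s1 (i - M)) (s1 i) (s2 k).
have := gm_sym gm1 (s1 (i - M)) (s2 (k - t)).
have := gm_sym gm1 (s1 (i - M)) (s1 i).
by lia.
Qed.

(** Away from the sides the path cannot leave the far region. *)
Lemma circuit_meets_side v u0 p : near_region (inl v) -> far_region u0 ->
  path region_edge u0 p -> last u0 p = inl v ->
  exists2 g, side g & inl g \in u0 :: p.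
Proof.
move=> nv; elim: p u0 => [|u p IH] u0 fu /=.
  by move=> _ uv; rewrite uv in fu; case: (regions_disjoint fu nv).
move=> /andP[/andP[_ /asboolP ok] pp] lp.
have [ou|ou] := pselect (on_side u0).
  by case: u0 ou {fu ok} => // g sg; exists g; rewrite ?mem_head.
have [ou'|ou'] := pselect (on_side u).
  by case: u ou' {ok pp lp} => // g sg; exists g; rewrite // !inE eqxx orbT.
have fu' : far_region u.
  case: ok => [[]//|[[nu _]|[]//]]; by case: (regions_disjoint fu nu).
have [g sg gp] := IH u fu' pp lp; exists g => //.
by rewrite inE gp orbT.
Qed.

End Regions.
End ConedRegions.

(** * Triangles are thin in a finer metric *)

Section RefinedThinness.
Variables (G V : eqType) (d1 dA : G -> G -> nat) (adj : rel (G + V)) (delta : nat).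
Hypotheses (gm1 : graph_metric d1) (thin1 : thin d1 delta).
Hypothesis adj_sym : symmetric adj.
Hypothesis adj_edge : forall g h, d1 g h = 1 -> adj (inl g) (inl h) \/
  exists2 x, adj (inl g) (inr x) & adj (inr x) (inl h).
Hypothesis adj_cone : forall g h x, adj (inl g) (inr x) -> adj (inl h) (inr x) ->
  d1 g h <= 1.
Hypothesis dA_refl : forall g, dA g g = 0.
Hypothesis adj_fine : forall N, exists C, forall v s, path adj (inl v) s ->
  adj (last (inl v) s) (inl v) -> uniq (inl v :: s) -> size s <= N ->
  forall g, inl g \in s -> dA v g <= C.

(** The loop runs from the successor of v along the geodesic to b, crosses to b' on
    another side, follows the sides to a', crosses to a and comes back to v.  Only
    the edge from v to its successor (or to the cone vertex in between) joins the
    near to the far region off the sides. *)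
Lemma thin_in_fine_metric : exists nu, forall q r m1 m2 v,
  geo d1 q m1 -> geo d1 r m2 -> q 0 = r 0 -> btw d1 (q m1) v (r m2) ->
  (exists2 i, i <= m1 & dA v (q i) <= nu) \/ (exists2 i, i <= m2 & dA v (r i) <= nu).
Proof.
(* A crossing of length delta at distance T from v stays on its side of v; D0
   bounds the distance from a' to b', M suits reach_detour, and N bounds the
   length of the loop. *)
pose T := delta + 2; pose D0 := 2 * delta + 2 * T.
pose M := T + 2 * delta + D0 + delta + 1.
pose N := 2 * T + 2 * delta + 2 * (2 * M + 2 * delta + D0) + 2 * delta + 2 * T + 1.
have [nu fine_nu] := adj_fine N.
exists nu => q r m1 m2 v gq gr qr bv.
pose side g := (exists2 i, i <= m1 & g = q i) \/ (exists2 i, i <= m2 & g = r i).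
suff [g sg vg] : exists2 g, side g & dA v g <= nu.
  by case: sg => -[i im gi]; [left | right]; exists i; rewrite // -gi.
have side_self : side v -> exists2 g, side g & dA v g <= nu.
  by exists v => //; rewrite dA_refl.
have sideq i : i <= m1 -> side (q i) by left; exists i.
have sider i : i <= m2 -> side (r i) by right; exists i.
have [c [c0 cj cm gc]] := geo_through gm1 bv.
set j := d1 (q m1) v in cj; set m := d1 (q m1) (r m2) in cm gc.
have jm : j <= m by rewrite /m -bv leq_addr.
have [j0|j0] := posnP j.
  by apply: side_self; rewrite -cj j0 c0; apply: sideq.
have [jm'|jm'] := leqP m j.
  have e : j = m by lia.
  by apply: side_self; rewrite -cj e cm; apply: sider.
pose T0 := minn j T; pose T1 := minn (m - j) T.
pose a := c (j - T0); pose b := c (j + T1).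
have near_side k (t : nat) : k <= m -> 0 < t -> (k = 0 \/ k = m \/ delta < t) ->
    exists g, [/\ side g, d1 (c k) g < t & d1 (c k) g <= delta].
  move=> km t0 [->|[->|dt]].
  - by exists (c 0); rewrite (gm_refl gm1); split=> //; rewrite c0; apply: sideq.
  - by exists (c m); rewrite (gm_refl gm1); split=> //; rewrite cm; apply: sider.
  have bk : btw d1 (q m1) (c k) (r m2) by rewrite -c0 -cm; apply: geo_btw.
  have [[i im ci]|[i im ci]] := thin1 gq gr qr bk.
    by exists (q i); split=> //; [apply: sideq | apply: leq_ltn_trans dt].
  by exists (r i); split=> //; [apply: sider | apply: leq_ltn_trans dt].
have T0pos : 0 < T0 by rewrite /T0 /T; lia.
have T1pos : 0 < T1 by rewrite /T1; lia.
have [|||a' [sa' aa' aad]] := near_side (j - T0) T0; try by rewrite /T0 /T; lia.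
have [|||b' [sb' bb' bbd]] := near_side (j + T1) T1; try by rewrite /T1 /T; lia.
rewrite -/a in aa' aad; rewrite -/b in bb' bbd.
have T0j : T0 <= j by rewrite /T0; lia.
have T0T : T0 <= T by rewrite /T0; lia.
have T1m : j + T1 <= m by rewrite /T1; lia.
have T1T : T1 <= T by rewrite /T1; lia.
have ac k : j - T0 <= k <= m -> d1 a (c k) = k - (j - T0).
  by move=> kk; rewrite /a gc.
have av : d1 a v = T0 by rewrite -cj ac; lia.
have ab : d1 a b = T0 + T1 by rewrite /b ac; lia.
pose E := region_edge d1 adj a T0 side.
have Es : symmetric E by exact: region_edge_sym.
have rs := reach_sym Es.
have r1 : reach E (2 * (T1 - 1)) (inl (c j.+1)) (inl b).
  have := @reach_geo _ _ _ adj a T0 side c j.+1 (T1 - 1) m gc.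
  have -> : j.+1 + (T1 - 1) = j + T1 by lia.
  apply=> [|k kl e]; first by lia.
  by apply: reach_far => //; rewrite ac; lia.
have r2 : reach E (2 * d1 b b') (inl b) (inl b').
  apply: reach_far_btw => // u; rewrite /btw => bu.
  by have := gm_tri gm1 a u b; have := gm_sym gm1 b u; lia.
have r4 : reach E (2 * d1 a a') (inl a) (inl a').
  by apply: reach_near_from => //; lia.
have r5 : reach E (2 * d1 a v) (inl a) (inl v).
  by apply: reach_near_from => //; rewrite av.
have r3 : reach E (2 * (2 * M + 2 * delta + D0)) (inl a') (inl b').
  have a'b' : d1 a' b' <= D0.
    have := gm_tri gm1 a' a b'; have := gm_tri gm1 a b b'.
    by have := gm_sym gm1 a a'; rewrite /D0; lia.
  have TM : T0 + 2 * delta < M by rewrite /M; lia.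
  have DM : D0 + delta < M by rewrite /M; lia.
  have detour s1 s2 n1 n2 i k : geo d1 s1 n1 -> geo d1 s2 n2 -> s1 0 = s2 0 ->
      (forall k, k <= n1 -> side (s1 k)) -> (forall k, k <= n2 -> side (s2 k)) ->
      i <= n1 -> k <= n2 -> a' = s1 i -> b' = s2 k ->
      reach E (2 * (2 * M + 2 * delta + D0)) (inl a') (inl b').
    move=> g1 g2 s12 ss1 ss2 i1 k2 ai bk; rewrite ai bk.
    apply: (reach_detour gm1 thin1 adj_sym adj_edge g1 g2 s12 ss1 ss2 i1 k2) => //.
      by rewrite -ai -bk.
    by rewrite -ai.
  case: sa' => -[i im ai]; case: sb' => -[k km bk].
  - exact: (detour q q m1 m1 i k).
  - exact: (detour q r m1 m2 i k).
  - exact: (detour r q m2 m1 i k).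
  - exact: (detour r r m2 m2 i k).
have loop : reach E (N - 1) (inl (c j.+1)) (inl v).
  apply: reach_le (reach_trans (reach_trans r1 r2)
    (reach_trans (rs _ _ _ r3) (reach_trans (rs _ _ _ r4) r5))).
  by rewrite /N; lia.
have nv : near_region d1 adj a T0 (inl v) by rewrite /= av.
have fs : far_region d1 adj a T0 (inl (c j.+1)) by rewrite /= ac; lia.
have vs : d1 v (c j.+1) = 1 by rewrite -cj gc; lia.
have [u0 [vu0 fu0 loop0]] : exists u0, [/\ adj (inl v) u0,
    far_region d1 adj a T0 u0 & reach E N u0 (inl v)].
  case: (adj_edge vs) => [e|[x vx xs]].
    by exists (inl (c j.+1)); split=> //; apply: reach_le loop; lia.
  exists (inr x); split=> //; first by exists (c j.+1); rewrite // adj_sym.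
  apply: reach_le (reach_trans (N := 1) _ loop); first by rewrite /N; lia.
  apply: reach1; rewrite /E /region_edge xs; apply/asboolP; left; split=> //.
  by exists (c j.+1); rewrite // adj_sym.
have [p [pp lp un sp]] := reach_uniq loop0.
have [g sg gp] := circuit_meets_side gm1 adj_cone nv fu0 pp lp.
exists g => //; case/lastP: p => [|p z] in pp lp un sp gp *.
  by rewrite /= in lp; rewrite lp in fu0; case: (regions_disjoint gm1 adj_cone fu0 nv).
rewrite last_rcons in lp; rewrite {z}lp in pp un sp gp.
move: pp; rewrite rcons_path => /andP[pp /andP[lv _]].
rewrite -rcons_cons rcons_uniq in un.
rewrite -rcons_cons mem_rcons inE in gp.
case/orP: gp => [/eqP[->]|gp]; first by rewrite dA_refl.
apply: (fine_nu v (u0 :: p)) => //=.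
- by rewrite vu0 /=; apply: sub_path pp => u u' /andP[].
- by rewrite size_rcons in sp.
Qed.

End RefinedThinness.

Local Open Scope group_scope.
Local Open Scope classical_set_scope.

(** * Cayley graphs and word metrics *)

Section Subgroups.
Variable G : groupType.
Implicit Types (A B H T : set G) (g h x y : G).

Lemma is_subgroupP H : is_subgroup H <->
  [/\ H 1, forall x, H x -> H x^-1 & forall x y, H x -> H y -> H (x * y)].
Proof.
split=> [[H1 Hd]|[H1 HV HM]].
  have h1 : H 1 by rewrite -in_setE.
  have hV x : H x -> H x^-1.
    by move=> Hx; rewrite -in_setE -[x^-1]mul1g; apply: Hd; apply: mem_set.
  split=> // x y Hx /hV Hy; rewrite -in_setE -[y]invgK.
  by apply: Hd; apply: mem_set.
split; first exact/mem_set.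
move=> x y /set_mem Hx /set_mem Hy.
by apply/mem_set/HM => //; apply: HV.
Qed.

Lemma generated_subgroup A : is_subgroup (generated A).
Proof.
apply/is_subgroupP; split=> [|x Ax|x y Ax Ay] H [sH AH].
- by case/is_subgroupP: sH.
- by case/is_subgroupP: (sH) => _ hV _; apply: hV; apply: Ax; split.
- case/is_subgroupP: (sH) => _ _ hM.
  by apply: hM; [apply: Ax; split | apply: Ay; split].
Qed.

Lemma sub_generated A : A `<=` generated A.
Proof. by move=> x Ax H [_]; apply. Qed.

Lemma generated_min A H : is_subgroup H -> A `<=` H -> generated A `<=` H.
Proof. by move=> sH AH x; apply. Qed.

Definition sym_closure A : set G := A `|` [set a^-1 | a in A].

Lemma sym_closure_sym A : symmetric_set (sym_closure A).
Proof.
by move=> x [Ax|[a Aa <-]]; [right; exists x | left; rewrite invgK].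
Qed.

Lemma symmetric_setU A B : symmetric_set A -> symmetric_set B -> symmetric_set (A `|` B).
Proof. by move=> sA sB x [/sA|/sB] h; [left | right]. Qed.

Lemma finite_sym_closure A : finite_set A -> finite_set (sym_closure A).
Proof. by move=> fA; rewrite finite_setU; split=> //; apply: finite_image. Qed.

Lemma cayleyE T x y : cayley T x y <-> T (x^-1 * y).
Proof. by rewrite /cayley /= in_setE. Qed.

Lemma cayley_sym T : symmetric_set T -> symmetric (cayley T).
Proof.
move=> sT x y; apply/idP/idP => /cayleyE/sT h; apply/cayleyE; move: h;
by rewrite invgM invgK.
Qed.

Lemma cayley_mull T g x y : cayley T (g * x) (g * y) = cayley T x y.
Proof. by rewrite /cayley /= invgM -mulgA mulKg. Qed.

Lemma walk_mull T g x y p : walk (cayley T) x y p ->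
  walk (cayley T) (g * x) (g * y) [seq g * z | z <- p].
Proof.
move=> [pp <-]; split; last by rewrite last_map.
by rewrite path_map (eq_path (e' := cayley T)) // => a b; apply: cayley_mull.
Qed.

Lemma gdist_mull T g x y : (forall x y, exists p, walk (cayley T) x y p) ->
  gdist (cayley T) (g * x) (g * y) = gdist (cayley T) x y.
Proof.
move=> conn.
suff le g' x' y' : gdist (cayley T) (g' * x') (g' * y') <= gdist (cayley T) x' y'.
  by apply/eqP; rewrite eqn_leq le /= -{1}(mulKg g x) -{1}(mulKg g y).
have [[p wp <-] _] := gdistP (conn x' y').
by have := gdist_le (walk_mull g' wp); rewrite size_map.
Qed.

Lemma walk_mono T T' x y p : T `<=` T' -> walk (cayley T) x y p -> walk (cayley T') x y p.
Proof.
by move=> TT' [pp lp]; split=> //; apply: sub_path pp => a b /cayleyE/TT' h; apply/cayleyE.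
Qed.

Lemma walk_generated A x y : generated A x -> generated A y ->
  exists p, walk (cayley (sym_closure A)) x y p.
Proof.
pose W : set G := [set g | exists p, walk (cayley (sym_closure A)) 1 g p].
have cs := cayley_sym (sym_closure_sym (A := A)).
have sub : generated A `<=` W.
  apply: generated_min; last first.
    move=> a Aa; exists [:: a]; split=> //=; rewrite andbT.
    by apply/cayleyE; rewrite invg1 mul1g; left.
  apply/is_subgroupP; split; first by exists [::].
    move=> g [p /(walk_mull g^-1)]; rewrite mulg1 mulVg => wp.
    by apply: walk_sym => //; eexists; exact: wp.
  move=> g h [p wp] [q /(walk_mull g)]; rewrite mulg1 => wq.
  by eexists; apply: walk_cat wp wq.
move=> gx gy; have /sub[p /(walk_mull x)] : generated A (x^-1 * y).
  have /is_subgroupP[_ hV hM] := generated_subgroup A.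
  by apply: hM => //; apply: hV.
by rewrite mulg1 mulVKg => wp; exists [seq x * z | z <- p].
Qed.

End Subgroups.

Section WordMetric.
Variables (G : groupType) (A : set G).
Hypotheses (finA : finite_set A) (genA : generated A = [set: G]).

Let conn x y : exists p, walk (cayley (sym_closure A)) x y p.
Proof. by apply: walk_generated; rewrite genA. Qed.

Lemma word_metric : graph_metric (word_dist A).
Proof. by apply: gdist_metric conn; apply/cayley_sym/sym_closure_sym. Qed.

Lemma word_dist_mull g x y : word_dist A (g * x) (g * y) = word_dist A x y.
Proof. exact: gdist_mull. Qed.

Lemma finite_word_ball x n : finite_set [set y | word_dist A x y <= n].
Proof.
have fT := finite_sym_closure finA.
elim: n x => [|n IH] x.
  apply: sub_finite_set (finite_set1 x) => y /=; rewrite leqn0 => /eqP.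
  by move=> /(gm_eq word_metric) ->.
have fU : finite_set (\bigcup_(t in sym_closure A) [set y | word_dist A (x * t) y <= n]).
  by apply: bigcup_finite => // t _.
apply: sub_finite_set (_ : finite_set (_ `|` [set x])) => [y /= xy|]; last first.
  by rewrite finite_setU; split; [exact: fU | exact: finite_set1].
have [[[|t p] [pp lp] sp] _] := gdistP (conn x y); first by right; rewrite -lp.
move: pp => /= /andP[/cayleyE xt pp]; left; exists (x^-1 * t) => //=.
rewrite mulVKg; apply: leq_trans (gdist_le (conj pp lp)) _.
have {}sp : (size p).+1 = word_dist A x y := sp.
by rewrite -sp in xy.
Qed.

Lemma finite_word_bounded (F : set G) : finite_set F ->
  exists C, forall f, F f -> word_dist A 1 f <= C.
Proof.
move=> /finite_seqP[s ->]; exists (\max_(f <- s) word_dist A 1 f) => f /= fs.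
exact: leq_bigmax_seq.
Qed.

End WordMetric.

(** * Fineness seen from the group *)

Lemma uniform_bound (T : eqType) (s : seq T) (Q : T -> nat -> Prop) :
  (forall x C C', C <= C' -> Q x C -> Q x C') ->
  (forall x, x \in s -> exists C, Q x C) -> exists C, forall x, x \in s -> Q x C.
Proof.
move=> mono; elim: s => [|y s IH] h; first by exists 0.
have [|C HC] := IH; first by move=> x xs; apply: h; rewrite inE xs orbT.
have [C' HC'] := h y (mem_head y s); exists (maxn C C') => x.
rewrite inE => /orP[/eqP->|/HC q]; first exact: mono (leq_maxr _ _) HC'.
exact: mono (leq_maxl _ _) q.
Qed.

Section Darts.
Variable K : graph.
Implicit Types (e f : dart K) (Z : seq (dart K)).

Definition dlink : rel (dart K) := [rel e f | tgt e == src f].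

Lemma tgt_rev e : tgt (Defs.rev e) = src e.
Proof. by rewrite /tgt Defs.revK. Qed.

(** If a circuit-to-be contains a dart d and its reverse, then each follows the
    other because the sources are distinct; so it has only these two darts. *)
Lemma circuit_of_path e Z : path dlink e Z -> tgt (last e Z) = src e ->
  uniq [seq src d | d <- e :: Z] -> last e Z != Defs.rev e -> circuit (e :: Z).
Proof.
move=> pZ cl un nrev; split=> //.
  by rewrite /= rcons_path; apply/andP; split; [exact: pZ | apply/eqP].
move=> d dc; apply/negP => rdc.
have cyc : cycle dlink (e :: Z) by rewrite /= rcons_path pZ; apply/eqP.
have [k c' ck] := rot_to dc.
have cyc' : cycle dlink (d :: c') by rewrite -ck rot_cycle.
have un' : uniq [seq src d | d <- d :: c'] by rewrite -ck map_rot rot_uniq.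
have rdc' : Defs.rev d \in d :: c' by rewrite -ck mem_rot.
have injs x y : x \in d :: c' -> y \in d :: c' -> src x = src y -> x = y.
  move=> xc yc exy; apply/eqP/negPn/negP => nxy.
  have := un'; case/splitPr: xc yc un' => p1 p2 yc un'.
  rewrite map_cat /= cat_uniq /= => /and3P[_ h1 /andP[h2 _]].
  move: yc; rewrite mem_cat inE eq_sym (negPf nxy) /= => /orP[yp|yp].
    by move: h1; rewrite negb_or exy => /andP[/negP[]]; apply: map_f.
  by move: h2; rewrite exy => /negP; apply; apply: map_f.
case: c' => [|x c'] in ck cyc' un' rdc' injs.
  by move: rdc'; rewrite inE (negPf (rev_neq d)).
move: cyc' => /= /andP[/eqP dx cx].
have xE : x = Defs.rev d.
  by apply: injs => //; rewrite ?inE ?eqxx ?orbT.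
case: c' => [|y c'] in ck cx un' rdc' injs.
  (* Only the two-dart cycle is left: its darts are e and the last dart of Z. *)
  have sz : size (e :: Z) = 2 by rewrite -(size_rot k) ck.
  case: Z => [|f [|? ?]] // in pZ cl un nrev dc rdc cyc ck sz.
  move: nrev => /= /eqP; apply.
  have : f \in [:: d; x] by rewrite -ck mem_rot !inE eqxx orbT.
  have : e \in [:: d; x] by rewrite -ck mem_rot !inE eqxx.
  have ef : e != f by apply: contraTneq un => ->; rewrite /= inE eqxx.
  rewrite !inE xE => /orP[]/eqP eE /orP[]/eqP fE; rewrite ?eE ?fE ?Defs.revK //.
  - by rewrite eE fE eqxx in ef.
  - by rewrite eE fE eqxx in ef.
move: cx => /= /andP[/eqP xy _].
have yE : y = d.
  by apply: injs; rewrite ?inE ?eqxx ?orbT // -xy xE tgt_rev.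
by move: un'; rewrite yE /= !inE eqxx orbT.
Qed.

(** The analogue of [shortenP] for darts: cutting between two darts with the same
    source keeps the last dart. *)
Lemma shorten_darts e Z : path dlink e Z ->
  exists Z', [/\ path dlink e Z', last e Z' = last e Z, uniq [seq src d | d <- Z'],
    size Z' <= size Z & {subset Z' <= Z}].
Proof.
have [m] := ubnP (size Z); elim: m Z => // m IH Z sZ pZ.
have [un|] := boolP (uniq [seq src d | d <- Z]); first by exists Z; split.
move=> nun; have : exists Z1 d1 Z2 d2 Z3,
    Z = Z1 ++ d1 :: Z2 ++ d2 :: Z3 /\ src d1 = src d2.
  elim: Z nun {sZ pZ} => //= d Z IHZ; rewrite negb_and negbK => /orP[|/IHZ].
    case/mapP => d2 /splitPr[Z2 Z3] dd2.
    by exists [::], d, Z2, d2, Z3.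
  by move=> [Z1 [d1 [Z2 [d2 [Z3 [-> ?]]]]]]; exists (d :: Z1), d1, Z2, d2, Z3.
move=> [Z1 [d1 [Z2 [d2 [Z3 [ZE d12]]]]]].
have [||Z' [p1 p2 p3 p4 p5]] := IH (Z1 ++ d2 :: Z3).
- by move: sZ; rewrite ZE !size_cat /= size_cat /=; lia.
- move: pZ; rewrite ZE !cat_path /= cat_path /= => /and4P[-> h1 _ /andP[_ ->]].
  by rewrite andbT /= /dlink /= -d12.
exists Z'; split=> //.
- by rewrite p2 ZE !last_cat /= last_cat.
- by apply: leq_trans p4 _; rewrite ZE !size_cat /= size_cat /=; lia.
- move=> d /p5; rewrite ZE !mem_cat !inE mem_cat inE.
  by case/or3P => ->; rewrite ?orbT.
Qed.

End Darts.

(** Darts are located in G by means of the marking mu, which writes each dart as a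
    translate of one of the finitely many representatives in D.  The marking is not
    equivariant, but it is up to a bounded error as edge stabilizers are finite. *)
Section DartMarking.
Variables (G : groupType) (A : set G) (K : graph) (a : graph_action G K).
Hypothesis genA : generated A = [set: G].
Hypothesis fineK : fine K.
Hypothesis fin_stab : forall e, finite_set (edge_stab a e).
Variables (D : seq (dart K)) (mu : dart K -> G).
Hypothesis muP : forall e, exists2 d, d \in D & actd a (mu e) d = e.

Local Notation dA := (word_dist A).
Let gmA := word_metric genA.

Lemma actdK g : cancel (actd a g) (actd a g^-1).
Proof. by move=> e; rewrite -actdM mulVg actd1. Qed.

Lemma actdVK g : cancel (actd a g^-1) (actd a g).
Proof. by move=> e; rewrite -actdM mulgV actd1. Qed.

Lemma actvK g : cancel (actv a g) (actv a g^-1).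
Proof. by move=> e; rewrite -actvM mulVg actv1. Qed.

Lemma act_tgt g e : tgt (actd a g e) = actv a g (tgt e).
Proof. by rewrite /tgt act_rev act_src. Qed.

Lemma dart_transporter_finite x d : finite_set [set k | actd a k x = d].
Proof.
have [[k0 /= k0x]|no] := pselect (exists k, actd a k x = d); last first.
  by apply: (sub_finite_set _ (finite_set0 G)) => k /= kx; apply: no; exists k.
apply: (sub_finite_set _ (finite_image (fun k => k0 * k) (fin_stab x))) => k /= kx.
exists (k0^-1 * k); last by rewrite mulVKg.
by rewrite /edge_stab /same_edge /= actdM kx -k0x actdK eqxx.
Qed.

Lemma mu_near (X : seq (dart K)) :
  exists C, forall x, x \in X -> forall g, dA g (mu (actd a g x)) <= C.
Proof.
apply: uniform_bound => [x C C' CC' h g|x _]; first exact: leq_trans (h g) CC'.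
pose F : set G := \bigcup_(d in [set` D]) [set k | actd a k x = d].
have fF : finite_set [set k^-1 | k in F].
  apply: finite_image; apply: bigcup_finite; first exact: finite_seq.
  by move=> d _; apply: dart_transporter_finite.
have [C HC] := finite_word_bounded A fF.
exists C => g; set m := mu _.
have [d dD md] := muP (actd a g x).
have -> : dA g m = dA 1 (g^-1 * m).
  by rewrite -[in RHS](word_dist_mull genA g) mulg1 mulVKg.
apply: HC; exists (m^-1 * g); last by rewrite invgM invgK.
by exists d => //=; rewrite actdM -md actdK.
Qed.

Lemma mu_rev : exists C, forall e, dA (mu e) (mu (Defs.rev e)) <= C.
Proof.
have [C HC] := mu_near [seq Defs.rev d | d <- D].
exists C => e; have [d dD de] := muP e.
by rewrite -{2}de act_rev; apply: HC; apply: map_f.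
Qed.

Lemma circuit_act g c : circuit c -> circuit [seq actd a g e | e <- c].
Proof.
have ig : injective (actd a g) := can_inj (actdK g).
have iv : injective (actv a g) := can_inj (actvK g).
move=> [c0 cyc un nr]; split.
- by case: c c0 {cyc un nr}.
- rewrite cycle_map; rewrite (eq_cycle (e' := [rel e f | tgt e == src f])) //.
  by move=> e f /=; rewrite act_tgt act_src (inj_eq iv).
- rewrite -map_comp (eq_map (g := actv a g \o @src K)).
    by rewrite map_comp map_inj_uniq.
  by move=> e /=; rewrite act_src.
- by move=> _ /mapP[e ec ->]; rewrite act_rev mem_map //; apply: nr.
Qed.

(** Up to translation the circuit contains a dart of D, and by fineness only
    finitely many short circuits do. *)
Lemma circuit_mu N : exists C, forall c e f, circuit c -> size c <= N ->
  e \in c -> f \in c -> dA (mu e) (mu f) <= C.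
Proof.
pose X : set (dart K) := \bigcup_(d in [set` D]) \bigcup_(n in [set` iota 0 N.+1])
  \bigcup_(c in [set c | [/\ circuit c, size c = n & has (same_edge d) c]]) [set` c].
have : finite_set X.
  apply: bigcup_finite => [|d _]; first exact: finite_seq.
  apply: bigcup_finite => [|n _]; first exact: finite_seq.
  by apply: bigcup_finite => [|c _]; [exact: fineK | exact: finite_seq].
move=> /finite_seqP[s sX]; have [C HC] := mu_near s.
exists C => c e f cc sc ec fc; have [d dD de] := muP e.
rewrite -(actdVK (mu e) f); apply: HC.
suff : X (actd a (mu e)^-1 f) by rewrite sX.
exists d => //; exists (size c); first by rewrite /mkset mem_iota; lia.
exists [seq actd a (mu e)^-1 x | x <- c]; last by rewrite /= map_f.
split; [exact: circuit_act | by rewrite size_map |].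
apply/hasP; exists d; last by rewrite /same_edge /= eqxx.
by apply/mapP; exists e => //; rewrite -{2}de actdK.
Qed.

(** A path leaving w by e and coming back for the first time by f contains a
    circuit through e and f, unless f is the reverse of e. *)
Lemma first_return N : exists C, forall w e Z, path (@dlink K) e Z ->
  src e = w -> tgt (last e Z) = w -> all (fun d => src d != w) Z -> size Z <= N ->
  dA (mu e) (mu (last e Z)) <= C.
Proof.
have [C1 H1] := mu_rev; have [C2 H2] := circuit_mu N.+1.
exists (maxn C1 C2) => w e Z pZ ew lw /allP aw sZ.
have [Z' [pZ' lZ un sZ' subZ]] := shorten_darts pZ.
rewrite -lZ in lw *.
have [eq|neq] := eqVneq (last e Z') (Defs.rev e).
  by rewrite eq; apply: leq_trans (H1 e) (leq_maxl _ _).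
apply: leq_trans (leq_maxr _ _); apply: (H2 (e :: Z')).
- apply: circuit_of_path; rewrite ?lw //= un andbT.
  by apply/mapP => -[d /subZ /aw]; rewrite -ew => /eqP h /esym.
- by rewrite /= ltnS; apply: leq_trans sZ.
- exact: mem_head.
- exact: mem_last.
Qed.

(** Between two consecutive visits to w there is a first return; so if the
    intermediate passages at w are bounded, so is the outer one. *)
Lemma closed_walk N C1 : exists C, forall w e Z,
  path (fun d d' => (tgt d == src d') &&
          ((src d' == w) ==> (dA (mu d) (mu d') <= C1))) e Z ->
  src e = w -> tgt (last e Z) = w -> size Z <= N ->
  dA (mu e) (mu (last e Z)) <= C.
Proof.
have [C2 H2] := first_return N.
exists (N.+1 * (C1 + C2))%N => w e Z.
suff gen m : size Z <= m -> m <= N -> path (fun d d' => (tgt d == src d') &&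
          ((src d' == w) ==> (dA (mu d) (mu d') <= C1))) e Z ->
    src e = w -> tgt (last e Z) = w -> dA (mu e) (mu (last e Z)) <= (m.+1 * (C1 + C2))%N.
  by move=> pZ ew lw sZ; apply: gen.
elim: m e Z => [|m IH] e Z sZ mN pZ ew lw.
  by case: Z sZ {pZ lw} => //= _; rewrite (gm_refl gmA).
have pZ' : path (@dlink K) e Z by apply: sub_path pZ => d d' /andP[].
have [aw|] := boolP (all (fun d => src d != w) Z).
  have := H2 w e Z pZ' ew lw aw (leq_trans sZ mN); rewrite mulSn; lia.
rewrite -has_predC => /(@split_find _ _ _) E.
case: E lw pZ pZ' sZ => d Z1 Z2 /= /negPn/eqP dw hZ1.
rewrite cat_rcons last_cat /= !cat_path size_cat /= => lw.
move=> /and3P[p1 /andP[/eqP ld cl] p2] /and3P[p1' _ p2'] sZ.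
rewrite dw eqxx /= in cl.
have h1 : dA (mu e) (mu (last e Z1)) <= C2.
  apply: (H2 w) => //; [by rewrite ld | | lia].
  by apply/allP => x xZ; have /hasPn/(_ x xZ)/= := hZ1; rewrite negbK.
have h2 : dA (mu d) (mu (last d Z2)) <= (m.+1 * (C1 + C2))%N.
  by apply: IH => //; lia.
have := gm_tri gmA (mu e) (mu (last e Z1)) (mu (last d Z2)).
have := gm_tri gmA (mu (last e Z1)) (mu d) (mu (last d Z2)).
by rewrite mulSn; lia.
Qed.

End DartMarking.

(** * Fineness of the coned-off graph *)

(** The coned-off graph: a cone vertex is represented by the vertex g w_i of K that
    the conjugate of P_i fixes. *)
Section ConedOff.
Variables (G : groupType) (A : set G) (K : graph) (a : graph_action G K).
Hypothesis genA : generated A = [set: G].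
Hypothesis fineK : fine K.
Hypothesis connK : forall x y, exists p, walk (@adjacent K) x y p.
Hypothesis fin_stab : forall e, finite_set (edge_stab a e).
Variables (D : seq (dart K)) (mu : dart K -> G).
Hypothesis muP : forall e, exists2 d, d \in D & actd a (mu e) d = e.
Variables (S : set G) (finS : finite_set S).
Variables (n : nat) (w : 'I_n -> vertex K) (v0 : vertex K).

Local Notation dA := (word_dist A).
Let gmA := word_metric genA.

Local Notation coned := (G + vertex K)%type.

Definition coned_adj : rel coned := fun u u' => match u, u' with
  | inl g, inl h => cayley S g h
  | inl g, inr x => `[< exists i, actv a g (w i) = x >]
  | inr x, inl g => `[< exists i, actv a g (w i) = x >]
  | inr _, inr _ => false end.

Definition position (u : coned) := match u with inl g => actv a g v0 | inr x => x end.

(** The path has to be nonempty, as its first and last darts are used to locate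
    its ends; going back and forth along a dart achieves this. *)
Lemma dart_walk x y : dart K -> exists e Z,
  [/\ path (@dlink K) e Z, src e = x & tgt (last e Z) = y].
Proof.
move=> e0.
have ne x' y' p : path (@adjacent K) x' p -> last x' p = y' -> p <> [::] ->
    exists e Z, [/\ path (@dlink K) e Z, src e = x' & tgt (last e Z) = y'].
  elim: p x' => // z p IH x' /= /andP[/asboolP[e [ex ez]] pp] lp _.
  have [p0|p0] := pselect (p = [::]).
    by exists e, [::]; rewrite p0 /= in lp; rewrite /= ez lp.
  have [e' [Z [pZ ez' lZ]]] := IH _ pp lp p0.
  by exists e, (e' :: Z); split=> //=; rewrite pZ andbT /dlink /= ez ez'.
have [p [pp lp]] := connK x y.
have [p0|p0] := pselect (p = [::]); last exact: ne pp lp p0.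
rewrite p0 /= in lp; rewrite -{y}lp {p pp p0}.
suff [e ex] : exists e : dart K, src e = x.
  exists e, [:: Defs.rev e]; split; rewrite //= ?tgt_rev // andbT.
  by rewrite /dlink /= /tgt.
have [p [pp lp]] := connK x (src e0).
have [p0|p0] := pselect (p = [::]); first by exists e0; rewrite p0 /= in lp.
by have [e [_ [_ ex _]]] := ne _ _ _ pp lp p0; exists e.
Qed.

Lemma piece_translates x y : dart K -> exists C, forall g, exists e Z,
  [/\ path (@dlink K) e Z, src e = actv a g x, tgt (last e Z) = actv a g y,
      size Z <= C & forall d, d \in e :: Z -> dA g (mu d) <= C].
Proof.
move=> e0; have [e [Z [pZ eZ lZ]]] := dart_walk x y e0.
have [C HC] := mu_near genA fin_stab muP (e :: Z).
exists (maxn (size Z) C) => g; exists (actd a g e), [seq actd a g d | d <- Z].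
split; rewrite ?act_src ?last_map ?act_tgt ?eZ ?lZ ?size_map ?leq_maxl //.
  rewrite path_map; apply: sub_path pZ => d d' /eqP dd'.
  by rewrite /dlink /= act_tgt act_src dd'.
move=> d; rewrite -map_cons => /mapP[d' d'Z ->].
by apply: leq_trans (HC _ d'Z g) (leq_maxr _ _).
Qed.

(** An edge joining g to a cone vertex g w_i is drawn as the translate by g of one
    path between v0 and w_i.  Thus, up to translation, there are finitely many pieces,
    although the peripheral subgroups are infinite. *)
Lemma piece : dart K -> exists C, forall u u', coned_adj u u' -> exists e Z,
  [/\ path (@dlink K) e Z, src e = position u, tgt (last e Z) = position u', size Z <= C &
      forall d g, d \in e :: Z -> u = inl g \/ u' = inl g -> dA g (mu d) <= C].
Proof.
move=> e0; move: (finS) => /finite_seqP[s sS].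
pose Q x y C := forall g, exists e Z,
  [/\ path (@dlink K) e Z, src e = actv a g x, tgt (last e Z) = actv a g y,
      size Z <= C & forall d, d \in e :: Z -> dA g (mu d) <= C].
have Qmono x y C C' : C <= C' -> Q x y C -> Q x y C'.
  move=> CC' q g; have [e [Z [? ? ? sZ dZ]]] := q g; exists e, Z; split=> //.
    exact: leq_trans CC'.
  by move=> d /dZ h; apply: leq_trans CC'.
have [C1 H1] : exists C, forall t, t \in s -> Q v0 (actv a t v0) C.
  by apply: uniform_bound => [t C C'|t _]; [exact: Qmono | exact: piece_translates].
have [C2 H2] : exists C, forall i, i \in enum 'I_n -> Q v0 (w i) C.
  by apply: uniform_bound => [t C C'|t _]; [exact: Qmono | exact: piece_translates].
have [C3 H3] : exists C, forall i, i \in enum 'I_n -> Q (w i) v0 C.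
  by apply: uniform_bound => [t C C'|t _]; [exact: Qmono | exact: piece_translates].
have [C4 H4] := finite_word_bounded A finS.
exists (C1 + C2 + C3 + C4) => -[g|x] [h|y] //=.
- move=> gh; have Sgh : S (g^-1 * h) by apply/cayleyE.
  have ts : (g^-1 * h) \in s by move: Sgh; rewrite sS.
  have [e [Z [p1 p2 p3 p4 p5]]] := H1 _ ts g.
  exists e, Z; split=> //; rewrite ?p3 -?actvM ?mulVKg //; first by lia.
  move=> d g' dZ [] [<-]; first by have := p5 d dZ; lia.
  have h4 : dA g h <= C4.
    have -> : dA g h = dA 1 (g^-1 * h).
      by rewrite -[in RHS](word_dist_mull genA g) mulg1 mulVKg.
    exact: H4.
  have := gm_tri gmA h g (mu d); have := gm_sym gmA h g.
  by have := p5 d dZ; lia.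
- move=> /asboolP[i iy].
  have [e [Z [p1 p2 p3 p4 p5]]] := H2 i (mem_enum _ _) g.
  exists e, Z; split=> //; rewrite ?p3 //; first by lia.
  by move=> d g' dZ [] // [<-]; have := p5 d dZ; lia.
- move=> /asboolP[i iy].
  have [e [Z [p1 p2 p3 p4 p5]]] := H3 i (mem_enum _ _) h.
  exists e, Z; split=> //; rewrite ?p2 //; first by lia.
  by move=> d g' dZ [] // [<-]; have := p5 d dZ; lia.
Qed.

Definition passing C x : rel (dart K) := fun d d' =>
  (tgt d == src d') && ((src d' == x) ==> (dA (mu d) (mu d') <= C)).

(** The path in K associated with a path of the coned-off graph.  A passage at x
    occurs inside a piece or at the position of a group element, and is bounded in
    both cases; a passage at a cone vertex would not be, whence the hypothesis. *)
Lemma expand : dart K -> exists C, forall x u0 u1 us, path coned_adj u0 (u1 :: us) ->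
  inr x \notin belast u1 us -> exists e Z,
  [/\ path (passing (2 * C)%N x) e Z, src e = position u0, tgt (last e Z) = position (last u1 us),
      size Z <= C * (size us).+1 &
      (forall g, u0 = inl g \/ u1 = inl g -> dA g (mu e) <= C) /\
      (forall g, last u0 (belast u1 us) = inl g -> dA g (mu (last e Z)) <= C)]%N.
Proof.
move=> e0; have [C0 HC0] := piece e0; pose C := C0.+1.
have HC u u' : coned_adj u u' -> exists e Z,
    [/\ path (@dlink K) e Z, src e = position u, tgt (last e Z) = position u', (size Z).+1 <= C &
      forall d g, d \in e :: Z -> u = inl g \/ u' = inl g -> dA g (mu d) <= C].
  move=> /HC0[e [Z [p1 p2 p3 p4 p5]]]; exists e, Z; split=> // d g dZ ug.
  by have := p5 d g dZ ug; rewrite /C; lia.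
have near_pass x g e Z : (forall d, d \in e :: Z -> dA g (mu d) <= C) ->
    path (@dlink K) e Z -> path (passing (2 * C)%N x) e Z.
  move=> hd; apply: (@sub_in_path _ [in e :: Z]); last exact/allP.
  move=> d d' dZ dZ' dd'; have {}dd' : tgt d == src d' := dd'.
  rewrite /passing dd'; apply/implyP => _.
  have := hd d dZ; have := hd d' dZ'; have := gm_tri gmA (mu d) g (mu d').
  by rewrite (gm_sym gmA (mu d) g); lia.
have has_inl u u' : coned_adj u u' -> exists g, u = inl g \/ u' = inl g.
  by case: u u' => [g|?] [h|?] //= _; [exists g; left | exists g; left | exists h; right].
exists C => x u0 u1 us.
elim: us u0 u1 => [|u2 us IH] u0 u1 /=.
  rewrite andbT => /[dup] /has_inl[g0 g0u] /HC[e [Z [p1 p2 p3 p4 p5]]] _.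
  exists e, Z; split=> //; last 1 first.
  - split=> [g ug|g ug]; first exact: (p5 e g (mem_head _ _) ug).
    exact: (p5 _ g (mem_last e Z) (or_introl ug)).
  - by apply: (near_pass _ g0) => // d dZ; apply: p5.
  - by lia.
move=> /andP[/[dup] /has_inl[g0 g0u] /HC[e [Z [p1 p2 p3 p4 p5]]] pp].
rewrite inE negb_or => /andP[nx1 nx].
have [e' [Z' [q1 q2 q3 q4 [q5 q6]]]] := IH u1 u2 pp nx.
exists e, (Z ++ e' :: Z'); split=> //.
- rewrite cat_path (near_pass _ g0) //=; last by move=> d dZ; apply: p5.
  clear g0 g0u; rewrite q1 andbT /passing p3 q2 eqxx /=.
  apply/implyP => /eqP px; case: u1 => [g|y] in pp p3 q2 q3 q4 q5 q6 px p5 nx1 nx *; last first.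
    by rewrite /= in px; rewrite px eqxx in nx1.
  have h1 := q5 g (or_introl erefl).
  have h2 := p5 _ g (mem_last e Z) (or_intror erefl).
  apply: leq_trans (gm_tri gmA (mu (last e Z)) g (mu e')) _.
  by rewrite mul2n -addnn leq_add // (gm_sym gmA).
- by rewrite last_cat.
- by rewrite size_cat /= mulnS; lia.
- split=> [g ug|g]; first exact: (p5 e g (mem_head _ _) ug).
  by rewrite last_cat /=; apply: q6.
Qed.

(** The closed path from the cone vertex x to h, to g and back to x is expanded
    in K, where its first and last darts are near h and near g. *)
Lemma isolated_hop_dart N : dart K -> exists C, forall x g h us,
  path coned_adj (inl h) us -> last (inl h) us = inl g -> inr x \notin inl h :: us ->
  coned_adj (inr x) (inl h) -> coned_adj (inl g) (inr x) -> size us <= N -> dA g h <= C.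
Proof.
move=> e0; have [C1 H1] := expand e0.
have [C2 H2] := closed_walk genA fineK fin_stab muP (C1 * N.+2)%N (2 * C1)%N.
exists (2 * C1 + C2)%N => x g h us p1 p2 p3 p4 p5 p6.
have pp' : path coned_adj (inl h) (rcons us (inr x)) by rewrite rcons_path p1 p2.
have pp : path coned_adj (inr x) (inl h :: rcons us (inr x)) by apply/andP.
have nx : inr x \notin belast (inl h) (rcons us (inr x)) by rewrite belast_rcons.
have [e [Z [q1 q2 q3 q4 [q5 q6]]]] := H1 x _ _ _ pp nx.
rewrite belast_rcons last_rcons size_rcons /= in q3 q4 q6.
have h1 := q5 h (or_intror erefl); have h2 := q6 g p2.
have h3 : dA (mu e) (mu (last e Z)) <= C2.
  apply: (H2 x) => //; apply: leq_trans q4 _; rewrite leq_mul2l; lia.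
have := gm_tri gmA g (mu (last e Z)) h.
have := gm_tri gmA (mu (last e Z)) (mu e) h.
by rewrite (gm_sym gmA (mu (last e Z)) (mu e)) (gm_sym gmA (mu e) h); lia.
Qed.

Lemma vertex_uniq_nodart (x y : vertex K) : (dart K -> False) -> x = y.
Proof.
move=> no; have [[|z p] [pp lp]] := connK x y; first exact: lp.
by move: pp => /andP[/asboolP[e _]]; case: (no e).
Qed.

Lemma cayley_bounded : exists C, forall g h, cayley S g h -> dA g h <= C.
Proof.
have [C HC] := finite_word_bounded A finS; exists C => g h /cayleyE Sgh.
have -> : dA g h = dA 1 (g^-1 * h); last exact: HC.
by rewrite -[in RHS](word_dist_mull genA g) mulg1 mulVKg.
Qed.

(** Without darts K has a single vertex, so a path avoiding x has no cone vertex. *)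
Lemma isolated_hop N : exists C, forall x g h us,
  path coned_adj (inl h) us -> last (inl h) us = inl g -> inr x \notin inl h :: us ->
  coned_adj (inr x) (inl h) -> coned_adj (inl g) (inr x) -> size us <= N -> dA g h <= C.
Proof.
have [[e0 _]|no] := pselect (exists e : dart K, True); first exact: isolated_hop_dart.
have {}no : dart K -> False by move=> e; apply: no; exists e.
have [C HC] := cayley_bounded; exists (N * C)%N => x g h us p1 p2 p3 _ _ sN.
rewrite (gm_sym gmA); apply: (@leq_trans (size us * C)); last by rewrite leq_mul2r sN orbT.
elim: us h p1 p2 p3 {sN} => [|u us IH] h /=.
  by move=> _ [->] _; rewrite (gm_refl gmA).
move=> /andP[hu pp] lu; rewrite !inE /= => nx.
case: u => [k|y] in hu pp lu nx *; last first.
  by rewrite (vertex_uniq_nodart y x no) eqxx in nx.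
have := IH k pp lu; rewrite inE /= => /(_ nx); have := HC _ _ hu.
by have := gm_tri gmA h k g; rewrite mulSn; lia.
Qed.

(** Rotating the circuit so that it starts at a cone vertex presents its two
    neighbours as an isolated hop. *)
Lemma coned_fine N : exists C, forall v s, path coned_adj (inl v) s ->
  coned_adj (last (inl v) s) (inl v) -> uniq (inl v :: s) -> size s <= N ->
  forall g, inl g \in s -> dA v g <= C.
Proof.
have [C1 H1] := cayley_bounded; have [C2 H2] := isolated_hop N.
exists (N * (C1 + C2))%N => v s ps cs us sN g gs.
have hop p q x k h : inl v :: s = p ++ inl k :: inr x :: inl h :: q -> dA k h <= C2.
  move=> E; have cyc : cycle coned_adj (inl v :: s) by rewrite /= rcons_path ps.
  have E' : inl v :: s = (p ++ [:: inl k; inr x]) ++ inl h :: q by rewrite -catA.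
  have cyc' : cycle coned_adj ((inl h :: q) ++ (p ++ [:: inl k; inr x])).
    rewrite -(rot_cycle (size (p ++ [:: inl k; inr x]))) in cyc.
    by move: cyc; rewrite E' rot_size_cat.
  have un' : uniq ((inl h :: q) ++ (p ++ [:: inl k; inr x])).
    by rewrite uniq_catC -E'.
  have sz : size (q ++ p) + 3 = (size s).+1.
    by rewrite -[(size s).+1]/(size (inl v :: s)) E !size_cat /=; lia.
  have e : (inl h :: q) ++ (p ++ [:: inl k; inr x]) =
      rcons (inl h :: rcons (q ++ p) (inl k)) (inr x).
    by rewrite /= -!cats1 -!catA.
  rewrite e in cyc' un'; move: cyc' un'.
  rewrite /= rcons_path last_rcons rcons_path => /andP[/andP[c1 c2] c3].
  rewrite last_rcons in c2 => /andP[hx]; rewrite rcons_uniq => /andP[xr _].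
  apply: (H2 x _ _ (rcons (q ++ p) (inl k))) => //; first by rewrite last_rcons.
  apply: leq_trans sN; rewrite size_rcons -ltnS -sz addn3; exact: leqnSn.
apply: (@leq_trans (size s * (C1 + C2))); last by rewrite leq_mul2r sN orbT.
have [m sm] := ubnP (size s).
elim: m v s {cs us sN} sm ps hop gs => // m IH v [|[k|x] s] // sm /= /andP[vk ps] hop.
  rewrite inE => /orP[/eqP[->]|gs].
    by have := H1 _ _ vk; rewrite mulSn; lia.
  have := IH k s _ ps _ gs; have := H1 _ _ vk; have := gm_tri gmA v k g.
  rewrite mulSn => h1 h2 h3.
  have : dA k g <= size s * (C1 + C2).
    apply: h3; first by move: sm => /=; lia.
    by move=> p q x k' h' E; apply: (hop (inl v :: p) q x); rewrite E.
  by lia.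
case: s => [|[k|y] s] in sm ps hop *; [by rewrite inE | | by case/andP: ps].
have vk' := hop [::] s x v k erefl; move: ps => /= /andP[_ ps].
rewrite inE /= inE => /orP[/eqP[->]|gs]; first by rewrite !mulSn; lia.
have := IH k s _ ps _ gs; have := gm_tri gmA v k g.
rewrite !mulSn => h2 h3.
have : dA k g <= size s * (C1 + C2).
  apply: h3; first by move: sm => /=; lia.
  by move=> p q x' k' h' E; apply: (hop [:: inl v, inr x & p] q x'); rewrite E.
by lia.
Qed.

End ConedOff.

(** * The relative Cayley graph and K *)

Section RelativeCayleyGraph.
Variables (G : groupType) (K : graph) (a : graph_action G K).
Hypothesis connK : forall x y, exists p, walk (@adjacent K) x y p.
Variables (D : seq (dart K)) (mu : dart K -> G).
Hypothesis muP : forall e, exists2 d, d \in D & actd a (mu e) d = e.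
Variables (n : nat) (P : 'I_n -> set G) (w : 'I_n -> vertex K) (v0 : vertex K).
Hypothesis P_stab : forall i, P i = vertex_stab a (w i).
Hypothesis P_inf : forall i, infinite_set (P i).
Hypothesis P_rep : forall x, infinite_set (vertex_stab a x) ->
  exists! i, exists g : G, vertex_stab a x = [set (y ^ g)%g | y in P i].
Variable S : set G.
Hypotheses (finS : finite_set S) (symS : symmetric_set S).

Local Notation T := (S `|` peripheral P).
Local Notation d1 := (gdist (cayley T)).
Local Notation dK := (gdist (@adjacent K)).
Hypothesis connT : forall x y, exists p, walk (cayley T) x y p.

Lemma stab_subgroup x : is_subgroup (vertex_stab a x).
Proof.
apply/is_subgroupP; split=> [|g gx|g h gx hx]; rewrite /vertex_stab /=.
- exact: actv1.
- by rewrite -{1}gx actvK.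
- by rewrite actvM hx.
Qed.

Lemma stab_act k x : vertex_stab a (actv a k x) = [set (y ^ k^-1)%g | y in vertex_stab a x].
Proof.
apply/seteqP; split=> [g /= gkx|_ [y /= yx <-]].
  exists (g ^ k); last by rewrite -conjgM mulgV conjg1.
  by rewrite /vertex_stab /= conjgE !actvM gkx actvK.
by rewrite /vertex_stab /= conjgE invgK !actvM actvK yx.
Qed.

(** The common vertex has an infinite stabilizer, conjugate both to P_i and to P_j;
    so i = j, as the P_i represent distinct conjugacy classes. *)
Lemma same_cone g h i j : actv a g (w i) = actv a h (w j) -> P i (g^-1 * h).
Proof.
move=> e; suff ij : i = j.
  by rewrite P_stab /vertex_stab /= actvM [in w i]ij -e actvK ij.
have inf : infinite_set (vertex_stab a (actv a g (w i))).
  rewrite stab_act -P_stab => fin; case: (@P_inf i).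
  have := finite_image (fun y => y ^ g) fin; rewrite image_comp.
  by rewrite (_ : _ \o _ = id) ?image_id //; apply/funext => y /=; rewrite -conjgM mulVg conjg1.
have [i0 [_ i0u]] := P_rep inf.
have <- : i0 = i by apply: i0u; exists g^-1; rewrite stab_act P_stab.
by apply: i0u; exists h^-1; rewrite e stab_act P_stab.
Qed.

Lemma peripheral_sym : symmetric_set (peripheral P).
Proof.
move=> x [[i _ Pix] /= x1]; split; last by move=> xV; apply: x1; rewrite -(invgK x) xV invg1.
exists i => //; move: Pix; rewrite P_stab.
by case/is_subgroupP: (stab_subgroup (w i)) => _ hV _; apply: hV.
Qed.

Lemma rel_metric : graph_metric d1.
Proof.
apply: gdist_metric connT; apply: cayley_sym.
exact: symmetric_setU symS peripheral_sym.
Qed.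
Let gm1 := rel_metric.

Lemma adj_metric : graph_metric dK.
Proof.
apply: gdist_metric connK => x y; rewrite /adjacent /=.
by apply/asboolP/asboolP => -[e [ex ey]]; exists (Defs.rev e); rewrite tgt_rev.
Qed.
Let gmK := adj_metric.

Lemma rel_dist_mull g x y : d1 (g * x) (g * y) = d1 x y.
Proof. exact: gdist_mull. Qed.

Lemma rel_dist1 g h : d1 g h = d1 1 (g^-1 * h).
Proof. by rewrite -[in RHS](rel_dist_mull g) mulg1 mulVKg. Qed.

Lemma rel_distM x y : d1 1 (x * y) <= d1 1 x + d1 1 y.
Proof. by apply: leq_trans (gm_tri gm1 1 x _) _; rewrite (rel_dist1 x) mulKg. Qed.

Lemma rel_dist_P i g : P i g -> d1 1 g <= 1.
Proof.
move=> Pg; have [->|g1] := eqVneq g 1; first by rewrite (gm_refl gm1).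
apply/gdist1/cayleyE; rewrite invg1 mul1g; right; split; first by exists i.
by move=> /eqP; rewrite (negPf g1).
Qed.

Lemma coned_adj_sym : symmetric (coned_adj a S w).
Proof. by move=> [g|x] [h|y] //=; apply: cayley_sym. Qed.

Lemma coned_adj_edge g h : d1 g h = 1%N -> coned_adj a S w (inl g) (inl h) \/
  exists2 x, coned_adj a S w (inl g) (inr x) & coned_adj a S w (inr x) (inl h).
Proof.
have [[[|x p] [pp lp] <-] _] := gdistP (connT g h) => //= -[] /size0nil p0.
move: pp lp; rewrite {p}p0 /= andbT => /cayleyE Th ?; subst h.
case: Th => [Sh|[[i _ Pi] _]]; first by left; apply/cayleyE.
right; exists (actv a g (w i)); apply/asboolP; exists i => //.
move: Pi; rewrite P_stab /vertex_stab /= => e.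
by rewrite -{2}e -actvM mulVKg.
Qed.

Lemma coned_adj_cone g h x : coned_adj a S w (inl g) (inr x) -> coned_adj a S w (inl h) (inr x) ->
  d1 g h <= 1.
Proof.
move=> /asboolP[i gx] /asboolP[j hx]; rewrite rel_dist1.
by apply: (@rel_dist_P i); apply: (@same_cone g h i j); rewrite gx hx.
Qed.

(** An infinite stabilizer is a conjugate of some P_i, and elements of P_i have
    length at most 1 in the relative metric. *)
Lemma transporter_bounded x y : exists C, forall k, actv a k x = y -> d1 1 k <= C.
Proof.
have [[k0 k0x]|no] := pselect (exists k, actv a k x = y); last first.
  by exists 0 => k kx; case: no; exists k.
suff [C HC] : exists C, forall g, vertex_stab a x g -> d1 1 g <= C.
  exists (d1 1 k0 + C) => k kx; rewrite -[k](mulVKg k0).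
  apply: leq_trans (rel_distM _ _) _; rewrite leq_add2l; apply: HC.
  by rewrite /vertex_stab /= actvM kx -k0x actvK.
have [fin|inf] := pselect (finite_set (vertex_stab a x)).
  move: fin => /finite_seqP[s sE].
  have [C HC] : exists C, forall g, g \in s -> d1 1 g <= C.
    apply: uniform_bound => [g C C' CC' h|g _]; first exact: leq_trans CC'.
    by exists (d1 1 g).
  by exists C => g; rewrite sE; apply: HC.
have [i [[g E] _]] := P_rep inf.
exists (d1 1 g^-1 + (1 + d1 1 g)) => h; rewrite E => -[p Pp <-].
rewrite conjgE; apply: leq_trans (rel_distM _ _) _; rewrite leq_add2l.
by apply: leq_trans (rel_distM _ _) _; rewrite leq_add2r; apply: rel_dist_P Pp.
Qed.

(** Consecutive edges of a path in K share a vertex, so the elements of G marking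
    them differ by an element carrying one representative vertex to another; there
    are finitely many pairs of representatives. *)
Lemma rel_dist_low : exists L, forall g h,
  d1 g h <= (L * (dK (actv a g v0) (actv a h v0)).+1)%N.
Proof.
pose Vr := v0 :: [seq src d | d <- D] ++ [seq tgt d | d <- D].
have [C HC] : exists C, forall xy, xy \in [seq (x, y) | x <- Vr, y <- Vr] ->
    forall k, actv a k xy.1 = xy.2 -> d1 1 k <= C.
  apply: uniform_bound => [xy C C' CC' h k kx|[x y] _]; last exact: transporter_bounded.
  by apply: leq_trans CC'; apply: h.
have close x y g h : x \in Vr -> y \in Vr -> actv a g x = actv a h y -> d1 g h <= C.
  move=> xV yV e; rewrite (gm_sym gm1) rel_dist1; apply: (HC (x, y)).
    exact: allpairs_f.
  by rewrite /= actvM e actvK.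
have srcV d : d \in D -> src d \in Vr.
  by move=> dD; rewrite inE mem_cat map_f ?orbT.
have tgtV d : d \in D -> tgt d \in Vr.
  by move=> dD; rewrite inE mem_cat (map_f (@tgt K)) ?orbT.
have key p x y g h : x \in Vr -> y \in Vr -> path (@adjacent K) (actv a g x) p ->
    last (actv a g x) p = actv a h y -> d1 g h <= (2 * C * size p + C)%N.
  elim: p x g => [|z p IH] x g xV yV /=; first by move=> _ /close; rewrite muln0; apply.
  move=> /andP[/asboolP[e [ex ez]] pp] lp; have [d dD de] := muP e.
  have h1 : d1 g (mu e) <= C.
    by apply: (close x (src d)); rewrite ?srcV // -act_src de ex.
  have zE : z = actv a (mu e) (tgt d) by rewrite -act_tgt de ez.
  rewrite zE in pp lp; have h2 := IH _ _ (tgtV d dD) yV pp lp.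
  by have := gm_tri gm1 g (mu e) h; rewrite mulnS; lia.
exists (2 * C)%N => g h; have [[p [pp lp] <-] _] := gdistP (connK (actv a g v0) (actv a h v0)).
apply: leq_trans (key p v0 v0 g h (mem_head _ _) (mem_head _ _) pp lp) _.
by rewrite mulnS addnC leq_add // leq_pmull.
Qed.

Lemma adjacent_act g x y : adjacent x y -> adjacent (actv a g x) (actv a g y).
Proof.
by move=> /asboolP[e [ex ey]]; apply/asboolP; exists (actd a g e);
  rewrite act_src act_tgt ex ey.
Qed.

Lemma dK_act g x y : dK (actv a g x) (actv a g y) <= dK x y.
Proof.
have [[p [pp lp] <-] _] := gdistP (connK x y); rewrite -(size_map (actv a g) p).
apply: gdist_le; split; last by rewrite last_map lp.
by rewrite path_map; apply: sub_path pp => u v; apply: adjacent_act.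
Qed.

Lemma rel_dist_up : exists L, forall g h, dK (actv a g v0) (actv a h v0) <= (L * d1 g h)%N.
Proof.
move: (finS) => /finite_seqP[s sE].
have [C1 H1] : exists C, forall t, t \in s -> dK v0 (actv a t v0) <= C.
  apply: uniform_bound => [t C C' CC' h|t _]; first exact: leq_trans CC'.
  by exists (dK v0 (actv a t v0)).
have [C2 H2] : exists C, forall i, i \in enum 'I_n -> dK v0 (w i) <= C.
  apply: uniform_bound => [t C C' CC' h|i _]; first exact: leq_trans CC'.
  by exists (dK v0 (w i)).
have step t : T t -> dK v0 (actv a t v0) <= C1 + 2 * C2.
  case=> [|[[i _]]]; first by rewrite sE => /H1; lia.
  rewrite P_stab /vertex_stab /= => tw _.
  have h1 := H2 i (mem_enum _ _); have := dK_act t (w i) v0; rewrite tw => h2.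
  by have := gm_tri gmK v0 (w i) (actv a t v0); have := gm_sym gmK v0 (w i); lia.
exists (C1 + 2 * C2) => g h; have [[p [pp lp] <-] _] := gdistP (connT g h).
elim: p g pp lp => [|x p IH] g /=; first by move=> _ ->; rewrite (gm_refl gmK).
move=> /andP[/cayleyE/step gx pp] lp; have h1 := IH x pp lp.
have h2 := dK_act g v0 (actv a (g^-1 * x) v0); rewrite -actvM mulVKg in h2.
apply: leq_trans (gm_tri gmK _ (actv a x v0) _) _.
by rewrite mulnS leq_add //; apply: leq_trans h2 gx.
Qed.

Lemma rel_thin delta : slim dK delta -> exists delta', thin d1 delta'.
Proof.
move=> sl; have [L1 H1] := rel_dist_up; have [L2 H2] := rel_dist_low.
pose L := maxn L1 L2.
apply: (thin_of_quasi_isometry (phi := fun g => actv a g v0) (L := L) gm1 gmK _ _ sl) => g h.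
  by apply: leq_trans (H1 g h) _; rewrite leq_mul2r leq_maxl orbT.
by apply: leq_trans (H2 g h) _; rewrite leq_mul2r leq_maxr orbT.
Qed.

End RelativeCayleyGraph.

(** * Undistorted subgroups *)

(** K plays two roles: being quasi-isometric to it makes the relative metric
    hyperbolic, and its fineness makes the circuits of the coned-off graph small. *)
Lemma rel_geodesics_thin (G : groupType) (A S : set G) n (P : 'I_n -> set G) :
  rel_hyperbolic P -> finite_set A -> generated A = [set: G] ->
  finite_set S -> symmetric_set S -> A `<=` S ->
  (forall x y, exists p, walk (cayley (S `|` peripheral P)) x y p) /\
  graph_metric (gdist (cayley (S `|` peripheral P))) /\
  exists nu, forall q r m1 m2 v,
    geo (gdist (cayley (S `|` peripheral P))) q m1 ->
    geo (gdist (cayley (S `|` peripheral P))) r m2 -> q 0 = r 0 ->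
    btw (gdist (cayley (S `|` peripheral P))) (q m1) v (r m2) ->
    (exists2 i, i <= m1 & word_dist A v (q i) <= nu) \/
    (exists2 i, i <= m2 & word_dist A v (r i) <= nu).
Proof.
move=> [_ _ [K [a [[[v0 _] connK] [delta hyp] fineK [fin_stab [s orb] [repP repU]]]]]].
move=> finA genA finS symS AS.
have /choice[w wP] : forall i, exists x, infinite_set (P i) /\ P i = vertex_stab a x.
  by move=> i; have [? [x ?]] := repP i; exists x.
pose D := s ++ [seq Defs.rev d | d <- s].
have /choice[mu muP] : forall e, exists g, exists2 d, d \in D & actd a g d = e.
  move=> e; have [g [f fs /orP[/eqP fe|/eqP fe]]] := orb e; exists g.
    by exists f; rewrite ?mem_cat ?fs.
  exists (Defs.rev f); first by rewrite mem_cat map_f ?orbT.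
  by rewrite -act_rev -[LHS]/(Defs.rev _) fe.
have P_inf i : infinite_set (P i) by case: (wP i).
have P_stab i : P i = vertex_stab a (w i) by case: (wP i).
have P_rep x : infinite_set (vertex_stab a x) ->
    exists! i, exists g, vertex_stab a x = [set (y ^ g)%g | y in P i].
  by move=> inf; apply: repU; split=> //; exists x.
have symT : symmetric_set (S `|` peripheral P).
  exact: symmetric_setU symS (peripheral_sym P_stab).
have connT x y : exists p, walk (cayley (S `|` peripheral P)) x y p.
  have [p wp] : exists p, walk (cayley (sym_closure A)) x y p.
    by apply: walk_generated; rewrite genA.
  exists p; apply: walk_mono wp => t [At|[t' At' <-]]; first by left; apply: AS.
  by left; apply/symS/AS.
have gm1 := rel_metric P_stab symS connT.
split=> //; split=> //.
have slimK : slim (gdist (@adjacent K)) delta.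
  exact: slim_of_hyperbolic hyp.
have [delta' thin1] := rel_thin connK muP v0 P_stab P_rep finS symS connT slimK.
apply: (thin_in_fine_metric gm1 thin1 (coned_adj_sym a w symS)).
- by move=> g h gh; exact: (coned_adj_edge P_stab connT gh).
- by move=> g h x; exact: (coned_adj_cone P_stab P_inf P_rep symS connT).
- by move=> g; apply: gm_refl (word_metric genA) _.
- by move=> N; exact: (coned_fine genA fineK connK fin_stab muP finS w v0).
Qed.

Local Open Scope ring_scope.
Import Order.TTheory GRing.Theory Num.Theory.

Lemma undistorted_nat (R : realType) (G : groupType) (H A B : set G) :
  qi_embedding H (fun x y => (word_dist B x y)%:R : R)
    (fun x y => (word_dist A x y)%:R : R) id ->
  exists L, forall x y, H x -> H y -> (word_dist B x y <= L * (word_dist A x y).+1)%N.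
Proof.
move=> [l [c [l1 c0 qi]]].
have l0 : 0 < l by apply: lt_le_trans l1.
exists (Num.bound (l + l * c)) => x y Hx Hy.
have /andP[h _] := qi x y Hx Hy.
have lc0 : 0 <= l * c by apply: mulr_ge0 => //; apply: ltW.
have lb := archi_boundP (addr_ge0 (ltW l0) lc0).
rewrite -(ler_nat R) natrM -natr1 mulrDr mulr1.
set N := (Num.bound _)%:R in lb *; set dB := _%:R in h *; set dA := _%:R in h *.
have e : dB = l * (l^-1 * dB) by rewrite mulrA divff ?mul1r // gt_eqF.
have h1 : dB <= l * (dA + c) by rewrite e ler_pM2l // -lerBlDr.
apply: le_trans h1 _; rewrite mulrDr lerD //.
  rewrite ler_wpM2r ?ler0n //; apply: le_trans (ltW lb); rewrite lerDl //.
by apply: le_trans (ltW lb); rewrite lerDr ltW.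
Qed.

Local Close Scope ring_scope.

(** Here [near_of_split] is applied to a geodesic of H, with dA-balls of radius
    nu k around v. *)
Lemma rel_geodesic_near_subgroup (G : groupType) (A B H : set G) (d1 : G -> G -> nat) nu L :
  generated A = [set: G] -> finite_set B -> generated B = H -> graph_metric d1 ->
  (forall q r m1 m2 v, geo d1 q m1 -> geo d1 r m2 -> q 0 = r 0 ->
    btw d1 (q m1) v (r m2) ->
    (exists2 i, i <= m1 & word_dist A v (q i) <= nu) \/
    (exists2 i, i <= m2 & word_dist A v (r i) <= nu)) ->
  (forall x y, cayley (sym_closure B) x y -> d1 x y <= 1) ->
  (forall x y, H x -> H y -> word_dist B x y <= (L * (word_dist A x y).+1)%N) ->
  exists D, forall x y v, H x -> H y -> btw d1 x v y ->
    exists2 h, H h & word_dist A v h <= D.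
Proof.
move=> genA finB genB gm1 thinA B1 und.
have gmA := word_metric genA.
have [CB HCB] := finite_word_bounded A (finite_sym_closure finB).
have [D HD] := near_of_split (nu + CB) L.
exists D => x y v Hx Hy bv.
have [c [c0 cm cadj gc]] : exists c, [/\ c 0 = x, c (word_dist B x y) = y,
    forall i, i < word_dist B x y -> cayley (sym_closure B) (c i) (c i.+1) &
    geo (word_dist B) c (word_dist B x y)].
  by apply: geodesic_fun; apply: walk_generated; rewrite genB.
set m := word_dist B x y in cm cadj gc.
have /is_subgroupP[_ HV HM] : is_subgroup H by rewrite -genB; apply: generated_subgroup.
have BH t : sym_closure B t -> H t.
  have BH' : B `<=` H by rewrite -genB; apply: sub_generated.
  by case=> [/BH'//|[t' /BH'/HV Ht <-]].
have Hc i : i <= m -> H (c i).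
  elim: i => [|i IH] im; first by rewrite c0.
  rewrite -(mulVKg (c i) (c i.+1)); apply: HM; first by apply: IH; lia.
  by apply/BH/cayleyE/cadj.
have [m0|m0] := posnP m.
  exists x => //; move: bv; rewrite -cm m0 c0 /btw (gm_refl gm1) => bv.
  by rewrite (_ : x = v) ?(gm_refl gmA) //; apply: (gm_eq gm1); lia.
pose near k x y := exists2 u, btw d1 x u y & word_dist A u v <= nu * k.
have [||||||i im ri] := HD G near (fun g => word_dist A g v) c m.
- by move=> k p q [u bu uv]; exists u => //; apply: leq_trans uv _; rewrite leq_mul2l leqnSn orbT.
- move=> k p t q [u bu uv].
  have [q1 [q10 q1m g1]] := gm_geo gm1 t p; have [q2 [q20 q2m g2]] := gm_geo gm1 t q.
  have bu' : btw d1 (q1 (d1 t p)) u (q2 (d1 t q)) by rewrite q1m q2m.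
  have close g : word_dist A u g <= nu -> word_dist A g v <= nu * k.+1.
    move=> ug; apply: leq_trans (gm_tri gmA g u v) _.
    by rewrite mulnS leq_add // (gm_sym gmA).
  have [[j jm uj]|[j jm uj]] := thinA q1 q2 _ _ u g1 g2 (etrans q10 (esym q20)) bu'.
    left; exists (q1 j); last exact: close.
    have := geo_btw g1 jm; rewrite q10 q1m /btw (gm_sym gm1 t p) (gm_sym gm1 t (q1 j)).
    by rewrite (gm_sym gm1 p (q1 j)) addnC.
  right; exists (q2 j); last exact: close.
  by have := geo_btw g2 jm; rewrite q20 q2m.
- move=> k i im [u bu uv].
  have d01 := B1 _ _ (cadj i im).
  have h4 : word_dist A (c i) (c i.+1) <= CB.
    rewrite -(word_dist_mull genA (c i)^-1) mulVg; apply: HCB.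
    by apply/cayleyE/cadj.
  have far g g' : g = u -> word_dist A g' g <= CB -> word_dist A g' v <= (nu + CB) * k.+1.
    move=> -> le; apply: leq_trans (gm_tri gmA g' u v) _; rewrite addnC mulnDl.
    apply: leq_add; last by apply: leq_trans le _; rewrite leq_pmulr.
    by apply: leq_trans uv _; rewrite leq_mul2l leqnSn orbT.
  have near_end g : g = u -> word_dist A g v <= (nu + CB) * k.+1.
    by move=> gu; apply: (far g) => //; rewrite (gm_refl gmA).
  have : c i = u \/ c i.+1 = u.
    rewrite /btw in bu; have [z|nz] := posnP (d1 (c i) u).
      by left; apply: gm_eq z.
    by right; apply: (gm_eq gm1); rewrite (gm_sym gm1); lia.
  case=> e; split; try exact: near_end.
    by apply: (far _ _ e); rewrite (gm_sym gmA).
  exact: (far _ _ e).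
- move=> i j ij; rewrite -gc //.
  apply: leq_trans (und _ _ (Hc i _) (Hc j _)) _; try lia.
  rewrite leq_mul2l ltnS; apply/orP; right.
  by apply: leq_trans (gm_tri gmA _ v _) _; rewrite (gm_sym gmA v).
- by [].
- by exists v; rewrite ?c0 ?cm // (gm_refl gmA).
by exists (c i); [apply: Hc | rewrite (gm_sym gmA)].
Qed.

Local Close Scope group_scope.
Local Close Scope classical_set_scope.

Theorem theorem1p5 (R : realType) (G : groupType) (n : nat)
    (P : 'I_n -> set G) (H : set G) :
  rel_hyperbolic P ->
  finitely_generated [set: G]%classic ->
  is_subgroup H ->
  finitely_generated H ->
  undistorted R H ->
  rel_quasiconvex R P H.
Proof.
move=> rh _ _ _ [A [B [finA genA finB genB qi]]].
have [L und] := undistorted_nat qi.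
pose S : set G := (sym_closure A `|` sym_closure B)%classic.
have finS : finite_set S by rewrite finite_setU; split; exact: finite_sym_closure.
have symS : symmetric_set S by apply: symmetric_setU; exact: sym_closure_sym.
have AS : (A `<=` S)%classic by move=> x Ax; left; left.
have [connT [gm1 [nu thinA]]] := rel_geodesics_thin rh finA genA finS symS AS.
have B1 x y : cayley (sym_closure B) x y ->
    gdist (cayley (S `|` peripheral P)%classic) x y <= 1.
  by move=> /cayleyE Bxy; apply/gdist1/cayleyE; left; right.
have [D HD] := rel_geodesic_near_subgroup genA finB genB gm1 thinA B1 und.
have gmA := word_metric genA.
exists S, (fun x y => (word_dist A x y)%:R : R)%R; split=> //.
- split=> //; apply/seteqP; split=> // x _.
  have : generated A x by rewrite genA.
  apply: generated_min; first exact: generated_subgroup.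
  by move=> y Ay; apply: sub_generated; left; apply: AS.
- split.
  + split=> [x y|x y|x y z].
    * split=> [/eqP|->]; last by rewrite (gm_refl gmA).
      by rewrite Num.Theory.pnatr_eq0 => /eqP /(gm_eq gmA).
    * by rewrite (gm_sym gmA).
    * by rewrite -natrD ler_nat; apply: gm_tri gmA _ _ _.
  + move=> x r; have [k rk] : exists k : nat, (r <= k%:R)%R.
      by exists (Num.bound `|r|)%R; apply: le_trans (ler_norm r) (ltW (archi_boundP _)).
    apply: sub_finite_set (finite_word_ball finA genA x k) => y /= xy.
    by rewrite -(ler_nat R); apply: le_trans rk.
  + by move=> g x y; rewrite word_dist_mull.
- exists (D%:R)%R => x y p Hx Hy gp v vp.
  have [|h Hh vh] := HD x y v Hx Hy; last by exists h; rewrite ?ler_nat.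
  exact: (geodesic_btw connT gp vp).
Qed.
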